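(* Let $n\geq1$ and $s,t\in\mathbb{N}$. In $\mathrm{Inv}(I^n,A)$ one has $$f_n^s\cdot f_n^t=\sum_{d=\max(s,t)}^{s+t}\binom{d}{s+t-d,\;d-s,\;d-t}\,\{-1\}^{n(s+t-d)}\,f_n^d,$$ where $\binom{d}{a,b,c}=\frac{d!}{a!\,b!\,c!}$ (with $a+b+c=d$) is the multinomial coefficient.
   Context: Setting. $k$ is a field of characteristic $\neq 2$; $K,L$ denote field extensions of $k$. Quadratic forms are nondegenerate. $GW(K)$, $W(K)$ are the Grothendieck–Witt and Witt rings; $\hat I(K)\subset GW(K)$ is the ideal of elements of virtual dimension $0$ and $I(K)\subset W(K)$ the fundamental ideal; the projection $\hat I(K)\to I(K)$ is an isomorphism, and $\hat I^n(K)$ and $I^n(K)$ are identified. $\langle\langle a\rangle\rangle=\langle1\rangle-\langle a\rangle\in\hat I(K)$, $\langle\langle a_1,\dots,a_n\rangle\rangle=\prod\langle\langle a_i\rangle\rangle$, and $\mathrm{Pf}_n(K)$ is the set of these $n$-fold Pfister elements. For functors $F$ (to sets) and $H$ (to abelian groups) on field extensions of $k$, $\mathrm{Inv}(F,H)$ is the group of natural transformations $F\to H$. $A$ is a functor from field extensions of $k$ to filtered commutative rings $A(K)=A^0(K)\supset A^1(K)\supset\cdots$, with $\bigcap_nA^n(K)=0$, together with a natural map $f_1:I(K)\to A^1(K)$ such that: (i) $\langle\langle a_1,\dots,a_n\rangle\rangle\mapsto\{a_1,\dots,a_n\}:=f_1(\langle\langle a_1\rangle\rangle)\cdots f_1(\langle\langle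 a_n\rangle\rangle)$ is a well-defined injective map $\mathrm{Pf}_n(K)\to A^n(K)$; (ii) for all $n\geq1$ this map extends to a group morphism $f_n:I^n(K)\to A^n(K)$; (iii) if $x\in A(K)$ satisfies $\{a\}\cdot x\in A^{d+1}(L)$ for all extensions $L/K$ and all $a\in L^*$, then $x\in A^d(K)$; (iv) for all $K$ and $n\geq 1$, every invariant of $\mathrm{Pf}_n$ over $K$ (i.e. on extensions of $K$) with values in $A$ is uniquely of the form $x+y f_n$ with $x,y\in A(K)$. (Examples: $A=W$ with $f_1=\mathrm{Id}$; $A=H^*(-,\mu_2)$ with $f_1=e_1$.) Let $\pi_n(t)=1-\frac{2}{1+(1+2^nt)^{1/2^{n-1}}}\in t+t^2\mathbb{Z}[[t]]$ and, for $x\in GW(K)$, let $\pi_n^d(x)$ be the coefficient of $t^d$ in $\lambda_{\pi_n(t)}(x)$, where $\lambda_t(x)=\sum\lambda^d(x)t^d$ for the usual exterior power operations of $GW(K)$. Then $\pi_n^d$ maps $I^n(K)$ to $I^{nd}(K)$; put $f_n^d=f_{nd}\circ\pi_n^d\in\mathrm{Inv}(I^n,A^{nd})$ for $d\geq1$ and $f_n^0=1$. $\{-1\}=f_1(\langle\langle-1\rangle\rangle)$, with $\{-1\}^0=1$; the product of invariants is pointwise. *)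

(* Defs.v *)
From HB Require Import structures.
From mathcomp Require Import all_boot all_order all_algebra perm.
From mathcomp Require Import ring.
From mathcomp Require Import boolp.

Set Implicit Arguments.
Unset Strict Implicit.
Unset Printing Implicit Defensive.

Import Order.TTheory GRing.Theory Num.Theory.
Local Open Scope ring_scope.
Local Open Scope quotient_scope.

Section IndexedMatrix.
Variable K : fieldType.

Definition fmx (T U : finType) (F : T -> U -> K) : 'M[K]_(#|T|, #|U|) :=
  \matrix_(i, j) F (enum_val i) (enum_val j).

Lemma fmx_mul (T U V : finType) (F : T -> U -> K) (G : U -> V -> K) :
  fmx F *m fmx G = fmx (fun s t => \sum_u F s u * G u t).
Proof.
apply/matrixP=> i j; rewrite !mxE [RHS](reindex (@enum_val _ predT)) /=.
  by apply: eq_bigr => u _; rewrite !mxE.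
exact: onW_bij (enum_val_bij U).
Qed.

Lemma fmx_tr (T U : finType) (F : T -> U -> K) :
  (fmx F)^T = fmx (fun u t => F t u).
Proof. by apply/matrixP=> i j; rewrite !mxE. Qed.

Lemma fmx1 (T : finType) : fmx (fun s t : T => (s == t)%:R) = 1%:M.
Proof.
by apply/matrixP=> i j; rewrite !mxE (inj_eq enum_val_inj).
Qed.

Lemma eq_fmx (T U : finType) (F G : T -> U -> K) :
  (forall t u, F t u = G t u) -> fmx F = fmx G.
Proof. by move=> FG; apply/matrixP=> i j; rewrite !mxE FG. Qed.

Definition kron m n p q (A : 'M[K]_(m, n)) (B : 'M[K]_(p, q)) :=
  fmx (fun (i : 'I_m * 'I_p) (j : 'I_n * 'I_q) => A i.1 j.1 * B i.2 j.2).

Lemma kron_mul m n p m' n' p' (A : 'M[K]_(m, n)) (B : 'M[K]_(n, p))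
    (A' : 'M[K]_(m', n')) (B' : 'M[K]_(n', p')) :
  kron A A' *m kron B B' = kron (A *m B) (A' *m B').
Proof.
rewrite fmx_mul; apply: eq_fmx => i j; rewrite !mxE big_distrlr /=.
by rewrite pair_big /=; apply: eq_bigr => u _; rewrite mulrACA.
Qed.

Lemma kron_tr m n p q (A : 'M[K]_(m, n)) (B : 'M[K]_(p, q)) :
  (kron A B)^T = kron A^T B^T.
Proof. by rewrite fmx_tr; apply: eq_fmx => i j; rewrite !mxE. Qed.

Lemma kron1 m n : kron (1%:M : 'M[K]_m) (1%:M : 'M[K]_n) = 1%:M.
Proof.
rewrite -fmx1; apply: eq_fmx => -[i i'] [j j']; rewrite !mxE /=.
by rewrite -natrM mulnb.
Qed.

(* Basis e_(i_1) /\ ... /\ e_(i_d), i_1 < ... < i_d, of the d-th exterior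
   power of K^n. *)
Definition incr d n := {t : d.-tuple 'I_n | sorted ltn (map val t)}.

(* Matrix of the d-th exterior power of a linear map; for a Gram matrix this
   is the Gram matrix of the form (x_1 /\ ... /\ x_d, y_1 /\ ... /\ y_d) |->
   det (b (x_i, y_j)). *)
Definition extmx d m n (A : 'M[K]_(m, n)) :=
  fmx (fun (S : incr d m) (T : incr d n) =>
         \det (mxsub (tnth (val S)) (tnth (val T)) A)).

Lemma extmx_tr d m n (A : 'M[K]_(m, n)) : (extmx d A)^T = extmx d A^T.
Proof.
by rewrite fmx_tr; apply: eq_fmx => S T; rewrite -det_tr; congr (\det _);
  apply/matrixP=> i j; rewrite !mxE.
Qed.

Lemma incr_inj d n (U : incr d n) : injective (tnth (val U)).
Proof.
apply/tuple_uniqP; rewrite -(map_inj_uniq val_inj).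
exact: (sorted_uniq ltn_trans ltnn (valP U)).
Qed.

Lemma incr_of_inj d n (f : 'I_d -> 'I_n) : injective f ->
  {U : incr d n | perm_eq (val U) (codom f)}.
Proof.
move=> finj; pose s := sort (fun i j : 'I_n => (i <= j)%N) (codom f).
have sz : size s == d by rewrite size_sort size_codom card_ord.
have srt : sorted ltn (map val (Tuple sz)).
  rewrite ltn_sorted_uniq_leq (map_inj_uniq val_inj) sort_uniq /=.
  apply/andP; split; first by apply/injectiveP.
  by rewrite sorted_map; apply: sort_sorted => i j; apply: leq_total.
by exists (Sub (Tuple sz) srt); rewrite /= perm_sort.
Qed.

Lemma incr_perm_eq d n (U V : incr d n) : perm_eq (val U) (val V) -> U = V.
Proof.
move=> UV; apply/val_inj/val_inj/(inj_map val_inj) => /=.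
apply: (irr_sorted_eq ltn_trans ltnn (valP U) (valP V)) => i.
by apply: perm_mem; apply: perm_map.
Qed.

Lemma cauchy_binet d n (A : 'M[K]_(d, n)) (B : 'M[K]_(n, d)) :
  \det (A *m B) =
  \sum_(U : incr d n) \det (colsub (tnth (val U)) A) *
                      \det (rowsub (tnth (val U)) B).
Proof.
have expand : \det (A *m B) =
    \sum_(f : {ffun 'I_d -> 'I_n}) (\prod_i A i (f i)) * \det (rowsub f B).
  rewrite /determinant; under eq_bigr => s _.
    under eq_bigr => i _ do rewrite mxE.
    rewrite bigA_distr_bigA big_distrr /=; over.
  rewrite exchange_big /=; apply: eq_bigr => f _; rewrite big_distrr /=.
  apply: eq_bigr => s _; rewrite big_split /= mulrCA; congr (_ * (_ * _)).
  by apply: eq_bigr => i _; rewrite mxE.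
rewrite expand (bigID (fun f : {ffun 'I_d -> 'I_n} => injectiveb f)) /=.
rewrite [X in _ + X]big1 ?addr0; last first.
  move=> f /injectivePn[i [j nij fij]].
  rewrite (@determinant_alternate _ _ _ i j) ?mulr0 // => l.
  by rewrite !mxE fij.
pose h (p : incr d n * 'S_d) := [ffun i => tnth (val p.1) (p.2 i)].
have hinj (p : incr d n * 'S_d) : injectiveb (h p).
  apply/injectiveP => i j; rewrite !ffunE => /incr_inj; exact: perm_inj.
have hperm (p : incr d n * 'S_d) : perm_eq (val p.1) (codom (h p)).
  apply: uniq_perm; first exact/tuple_uniqP/incr_inj.
    exact/injectiveP/injectiveP/hinj.
  move=> x; apply/idP/codomP => [/tnthP[i ->]|[i ->]].
    by exists ((p.2^-1)%g i); rewrite ffunE permKV.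
  by rewrite ffunE mem_tnth.
have hI : injective h.
  move=> [U s] [V t] E; have UV : U = V.
    apply: incr_perm_eq; apply: perm_trans (hperm (U, s)) _.
    by rewrite E perm_sym; apply: (hperm (V, t)).
  rewrite -UV in E *; congr pair; apply/permP=> i.
  by move/ffunP/(_ i): E; rewrite !ffunE => /incr_inj.
have hS (f : {ffun 'I_d -> 'I_n}) : injectiveb f -> exists p, f = h p.
  move/injectiveP => fI; have [U Uf] := incr_of_inj fI.
  have ex i : exists j, f i == tnth (val U) j.
    have /tnthP[j ->] : f i \in val U by rewrite (perm_mem Uf) codom_f.
    by exists j.
  have gE i : f i = tnth (val U) (xchoose (ex i)) := eqP (xchooseP (ex i)).
  have gI : injective (fun i => xchoose (ex i)).
    by move=> i j gij; apply: fI; rewrite !gE gij.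
  by exists (U, perm gI); apply/ffunP=> i; rewrite !ffunE permE -gE.
have -> : \sum_(f : {ffun 'I_d -> 'I_n} | injectiveb f)
    (\prod_i A i (f i)) * \det (rowsub f B) =
    \sum_p (\prod_i A i (h p i)) * \det (rowsub (h p) B).
  rewrite -(big_imset (fun f : {ffun 'I_d -> 'I_n} =>
    (\prod_i A i (f i)) * \det (rowsub f B)) (in2W hI)) /=.
  apply: eq_bigl => f; apply/idP/imsetP => [/hS[p ->]|[p _ ->]]; last exact: hinj.
  by exists p.
rewrite -(pair_bigA _ (fun U s => (\prod_i A i (h (U, s) i)) *
  \det (rowsub (h (U, s)) B))) /=.
apply: eq_bigr => U _; rewrite {2}/determinant big_distrl /=.
apply: eq_bigr => s _.
have -> : rowsub (h (U, s)) B = row_perm s (rowsub (tnth (val U)) B).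
  by apply/matrixP=> i j; rewrite !mxE ffunE.
rewrite row_permE det_mulmx det_perm mulrA [X in X * _]mulrC; congr (_ * _ * _).
by apply: eq_bigr => i _; rewrite mxE ffunE.
Qed.

Lemma extmx_mul d m n p (A : 'M[K]_(m, n)) (B : 'M[K]_(n, p)) :
  extmx d A *m extmx d B = extmx d (A *m B).
Proof.
rewrite fmx_mul; apply: eq_fmx => S T; rewrite mxsub_mul cauchy_binet.
apply: eq_bigr => U _ /=.
by congr (_ * _); congr (\det _); apply/matrixP=> i j; rewrite !mxE.
Qed.

Lemma extmx1 d n : extmx d (1%:M : 'M[K]_n) = 1%:M.
Proof.
rewrite -fmx1; apply: eq_fmx => S T; have [<-|nST] := eqVneq S T.
  rewrite -[RHS](det1 K d); congr (\det _); apply/matrixP=> i j.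
  by rewrite !mxE (inj_eq (@incr_inj _ _ S)).
have [sub|/allPn[x xS xT]] := boolP (all (mem (val T)) (val S)).
  case/eqP: nST; apply: incr_perm_eq; apply: uniq_perm; try exact/tuple_uniqP/incr_inj.
  have ST : {subset val S <= val T} by apply/allP.
  have uS : uniq (val S) by apply/tuple_uniqP/incr_inj.
  have sz : (size (val T) <= size (val S))%N by rewrite !size_tuple.
  by have [_] := uniq_min_size uS ST sz.
have /tnthP[i xE] := xS.
apply/eqP; rewrite (expand_det_row _ i) big1 // => j _; rewrite !mxE.
case: eqP => [e|_]; last by rewrite mul0r.
by move: xT; rewrite xE e /= mem_tnth.
Qed.

Lemma rowsub_bij m n (g : 'I_m -> 'I_n) (h : 'I_n -> 'I_m) :
  cancel h g -> rowsub h 1%:M *m rowsub g 1%:M = 1%:M :> 'M[K]_n.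
Proof.
by move=> hK; rewrite mul_rowsub_mx mul1mx; apply/matrixP=> i j; rewrite !mxE hK.
Qed.

End IndexedMatrix.

(* A nondegenerate quadratic form over K, given by its Gram matrix in a basis
   (char K <> 2, so quadratic and symmetric bilinear forms agree). *)
Record qform (K : fieldType) := QForm {
  qdim : nat;
  gram : 'M[K]_qdim;
  gram_sym : gram^T = gram;
  gram_unit : gram \in unitmx
}.

HB.instance Definition _ (K : fieldType) := gen_eqMixin (qform K).
HB.instance Definition _ (K : fieldType) := gen_choiceMixin (qform K).

Section Forms.
Variable K : fieldType.
Implicit Types q : qform K.

Definition isometric q q' : Prop :=
  exists (P : 'M[K]_(qdim q, qdim q')) (P' : 'M[K]_(qdim q', qdim q)),
    [/\ P *m P' = 1%:M, P' *m P = 1%:M & P *m gram q' *m P^T = gram q].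

Lemma isometric_refl q : isometric q q.
Proof. by exists 1%:M, 1%:M; rewrite trmx1 !mulmx1 mul1mx. Qed.

Lemma isometric_sym q q' : isometric q q' -> isometric q' q.
Proof.
move=> [P [P' [PP' P'P E]]]; exists P', P; split=> //.
by rewrite -E !mulmxA P'P mul1mx -mulmxA -trmx_mul P'P trmx1 mulmx1.
Qed.

Lemma isometric_trans q1 q2 q3 :
  isometric q1 q2 -> isometric q2 q3 -> isometric q1 q3.
Proof.
move=> [P [P' [PP' P'P E]]] [Q [Q' [QQ' Q'Q F]]].
exists (P *m Q), (Q' *m P'); split.
- by rewrite mulmxA -(mulmxA P) QQ' mulmx1.
- by rewrite mulmxA -(mulmxA Q') P'P mulmx1.
- by rewrite -E -F trmx_mul !mulmxA.
Qed.

Lemma isometric_bij q q' (g : 'I_(qdim q) -> 'I_(qdim q')) :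
  bijective g -> (forall i j, gram q i j = gram q' (g i) (g j)) ->
  isometric q q'.
Proof.
move=> [h hK gK] E; exists (rowsub g 1%:M), (rowsub h 1%:M).
split; try exact: rowsub_bij.
rewrite mul_rowsub_mx mul1mx; apply/matrixP=> i j; rewrite E !mxE.
rewrite (bigD1 (g j)) //= !mxE eqxx mulr1 big1 ?addr0 // => k kj.
by rewrite !mxE eq_sym (negPf kj) mulr0.
Qed.

Lemma unitmx_inv n (A B : 'M[K]_n) : A *m B = 1%:M -> A \in unitmx.
Proof. by move/mulmx1_unit => []. Qed.

Fact orth_sym q q' :
  (block_mx (gram q) 0 0 (gram q'))^T = block_mx (gram q) 0 0 (gram q').
Proof. by rewrite tr_block_mx !trmx0 !gram_sym. Qed.
Fact orth_unit q q' : block_mx (gram q) 0 0 (gram q') \in unitmx.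
Proof. by rewrite block_diag_mx_unit !gram_unit. Qed.
Definition orth q q' := QForm (orth_sym q q') (orth_unit q q').

Fact tens_sym q q' : (kron (gram q) (gram q'))^T = kron (gram q) (gram q').
Proof. by rewrite kron_tr !gram_sym. Qed.
Fact tens_unit q q' : kron (gram q) (gram q') \in unitmx.
Proof.
apply: (@unitmx_inv _ _ (kron (invmx (gram q)) (invmx (gram q')))).
by rewrite kron_mul !mulmxV ?gram_unit // kron1.
Qed.
Definition tens q q' := QForm (tens_sym q q') (tens_unit q q').

Fact ext_sym d q : (extmx d (gram q))^T = extmx d (gram q).
Proof. by rewrite extmx_tr gram_sym. Qed.
Fact ext_unit d q : extmx d (gram q) \in unitmx.
Proof.
apply: (@unitmx_inv _ _ (extmx d (invmx (gram q)))).
by rewrite extmx_mul mulmxV ?gram_unit // extmx1.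
Qed.
Definition ext d q := QForm (ext_sym d q) (ext_unit d q).

Fact qzero_sym : (0 : 'M[K]_0)^T = 0.
Proof. exact: trmx0. Qed.
Fact qzero_unit : (0 : 'M[K]_0) \in unitmx.
Proof. by rewrite unitmxE det_mx00 unitr1. Qed.
Definition qzero := QForm qzero_sym qzero_unit.

Definition Kstar := {a : K | a != 0}.

Fact diag1_sym (a : Kstar) : ((val a)%:M : 'M[K]_1)^T = (val a)%:M.
Proof. exact: tr_scalar_mx. Qed.
Fact diag1_unit (a : Kstar) : ((val a)%:M : 'M[K]_1) \in unitmx.
Proof. by rewrite unitmxE det_scalar1 unitfE (valP a). Qed.
Definition diag1 (a : Kstar) := QForm (diag1_sym a) (diag1_unit a).

Fact one_neq0 : (1 : K) != 0. Proof. exact: oner_neq0. Qed.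
Fact m1_neq0 : (-1 : K) != 0. Proof. by rewrite oppr_eq0 oner_neq0. Qed.
Definition Kone : Kstar := exist _ 1 one_neq0.
Definition Kopp1 : Kstar := exist _ (-1) m1_neq0.

Lemma orth_isom q1 q1' q2 q2' :
  isometric q1 q1' -> isometric q2 q2' -> isometric (orth q1 q2) (orth q1' q2').
Proof.
move=> [P [P' [PP' P'P E]]] [Q [Q' [QQ' Q'Q F]]].
exists (block_mx P 0 0 Q), (block_mx P' 0 0 Q'); split.
- by rewrite mulmx_block !(mulmx0, mul0mx, addr0, add0r) PP' QQ' -scalar_mx_block.
- by rewrite mulmx_block !(mulmx0, mul0mx, addr0, add0r) P'P Q'Q -scalar_mx_block.
- by rewrite tr_block_mx /= !mulmx_block !trmx0 !(mulmx0, mul0mx, addr0, add0r) E F.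
Qed.

Lemma tens_isom q1 q1' q2 q2' :
  isometric q1 q1' -> isometric q2 q2' -> isometric (tens q1 q2) (tens q1' q2').
Proof.
move=> [P [P' [PP' P'P E]]] [Q [Q' [QQ' Q'Q F]]].
exists (kron P Q), (kron P' Q'); split.
- by rewrite kron_mul PP' QQ' kron1.
- by rewrite kron_mul P'P Q'Q kron1.
- by rewrite kron_tr !kron_mul E F.
Qed.

Lemma ext_isom d q q' : isometric q q' -> isometric (ext d q) (ext d q').
Proof.
move=> [P [P' [PP' P'P E]]]; exists (extmx d P), (extmx d P'); split.
- by rewrite extmx_mul PP' extmx1.
- by rewrite extmx_mul P'P extmx1.
- by rewrite extmx_tr !extmx_mul E.
Qed.

Lemma isometric_qdim q q' : isometric q q' -> qdim q = qdim q'.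
Proof.
move=> [P [P' [PP' P'P _]]]; apply/eqP; rewrite eqn_leq.
by rewrite (mulmx1_min PP') (mulmx1_min P'P).
Qed.

(* Coordinate families, to reindex Gram matrices along bijections. *)
Definition rep q (T : finType) (b : T -> T -> K) :=
  exists2 g : 'I_(qdim q) -> T, bijective g &
    forall i j, gram q i j = b (g i) (g j).

Lemma rep_isom q q' (T U : finType) b c (g : T -> U) :
  rep q b -> rep q' c -> bijective g -> (forall i j, b i j = c (g i) (g j)) ->
  isometric q q'.
Proof.
move=> [h hB hE] [h' [l lK Kl] hE'] gB E.
apply: (@isometric_bij _ _ (fun i => l (g (h i)))).
  by apply: (bij_comp (f := l)); [exists h' | apply: bij_comp].
by move=> i j; rewrite hE hE' !Kl E.
Qed.

Lemma rep_self q : rep q (gram q).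
Proof. by exists id => //; exists id. Qed.

Definition sumb (T U : Type) (b : T -> T -> K) (c : U -> U -> K) (x y : T + U) :=
  match x, y with
  | inl i, inl j => b i j
  | inr i, inr j => c i j
  | _, _ => 0
  end.

Definition prodb (T U : Type) (b : T -> T -> K) (c : U -> U -> K)
  (x y : T * U) := b x.1 y.1 * c x.2 y.2.

Lemma rep_orth q q' (T U : finType) (b : T -> T -> K) (c : U -> U -> K) :
  rep q b -> rep q' c -> rep (orth q q') (sumb b c).
Proof.
move=> [g [g' gK Kg] gE] [h [h' hK Kh] hE].
exists (fun i => match split i with inl j => inl (g j) | inr j => inr (h j) end).
  exists (fun x => unsplit (match x with inl j => inl (g' j) | inr j => inr (h' j) end)).
    by move=> i; rewrite -[RHS]splitK; case: (split i) => j; rewrite ?gK ?hK.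
  by case=> j; rewrite unsplitK ?Kg ?Kh.
by move=> i j; rewrite /= !mxE; case: (split i) => k; rewrite !mxE;
   case: (split j) => l; rewrite ?gE ?hE ?mxE.
Qed.

Lemma rep_tens q q' (T U : finType) (b : T -> T -> K) (c : U -> U -> K) :
  rep q b -> rep q' c -> rep (tens q q') (prodb b c).
Proof.
move=> [g [g' gK Kg] gE] [h [h' hK Kh] hE].
exists (fun i => let p := enum_val i in (g p.1, h p.2)).
  exists (fun x => enum_rank (g' x.1, h' x.2)).
    by move=> i /=; rewrite gK hK -surjective_pairing enum_valK.
  by case=> x y /=; rewrite enum_rankK /= Kg Kh.
by move=> i j; rewrite /= mxE gE hE.
Qed.

Lemma orthA q1 q2 q3 : isometric (orth q1 (orth q2 q3)) (orth (orth q1 q2) q3).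
Proof.
pose g (x : 'I_(qdim q1) + ('I_(qdim q2) + 'I_(qdim q3))) :=
  match x with inl i => inl (inl i) | inr (inl i) => inl (inr i)
  | inr (inr i) => inr i end.
apply: (@rep_isom _ _ _ _ _ _ g).
- exact: rep_orth (rep_self _) (rep_orth (rep_self _) (rep_self _)).
- exact: rep_orth (rep_orth (rep_self _) (rep_self _)) (rep_self _).
- exists (fun x => match x with inl (inl i) => inl i | inl (inr i) => inr (inl i)
     | inr i => inr (inr i) end); first by case=> [|[]].
  by case=> [[]|].
- by case=> [i|[i|i]] [j|[j|j]].
Qed.

Lemma orthC q1 q2 : isometric (orth q1 q2) (orth q2 q1).
Proof.
pose g (T U : Type) (x : T + U) : U + T :=
  match x with inl i => inr i | inr i => inl i end.
apply: (@rep_isom _ _ _ _ _ _ (@g 'I_(qdim q1) 'I_(qdim q2))).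
- exact: rep_orth (rep_self _) (rep_self _).
- exact: rep_orth (rep_self _) (rep_self _).
- by exists (@g _ _); case.
- by case=> i [].
Qed.

Lemma orth0 q : isometric (orth qzero q) q.
Proof.
pose g (x : 'I_0 + 'I_(qdim q)) : 'I_(qdim q) :=
  match x with inl i => let: Ordinal _ h := i in False_rect _ (notF h)
  | inr i => i end.
apply: (@rep_isom _ _ _ _ _ _ g).
- exact: rep_orth (rep_self _) (rep_self _).
- exact: rep_self.
- by exists inr; first by case=> // -[].
- by case=> [[]|i] // [[]|j].
Qed.

Lemma tensA q1 q2 q3 : isometric (tens q1 (tens q2 q3)) (tens (tens q1 q2) q3).
Proof.
pose g (x : 'I_(qdim q1) * ('I_(qdim q2) * 'I_(qdim q3))) := (x.1, x.2.1, x.2.2).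
apply: (@rep_isom _ _ _ _ _ _ g).
- exact: rep_tens (rep_self _) (rep_tens (rep_self _) (rep_self _)).
- exact: rep_tens (rep_tens (rep_self _) (rep_self _)) (rep_self _).
- by exists (fun x => (x.1.1, (x.1.2, x.2))); [case=> ? []|case=> -[]].
- by case=> i [i' i''] [j [j' j'']]; rewrite /prodb /= mulrA.
Qed.

Lemma tensC q1 q2 : isometric (tens q1 q2) (tens q2 q1).
Proof.
apply: (@rep_isom _ _ _ _ _ _ (fun x : 'I_(qdim q1) * 'I_(qdim q2) => (x.2, x.1))).
- exact: rep_tens (rep_self _) (rep_self _).
- exact: rep_tens (rep_self _) (rep_self _).
- by exists (fun x => (x.2, x.1)); case.
- by case=> i i' [j j']; rewrite /prodb /= mulrC.
Qed.

Lemma tens1 q : isometric (tens (diag1 Kone) q) q.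
Proof.
apply: (@rep_isom _ _ _ _ _ _ (fun x : 'I_1 * 'I_(qdim q) => x.2)).
- exact: rep_tens (rep_self _) (rep_self _).
- exact: rep_self.
- exists (fun x => (0, x)); last by [].
  by case=> i j; rewrite [i]ord1.
- by case=> i i' [j j']; rewrite /prodb /= !ord1 mxE eqxx mul1r.
Qed.

Lemma tens0 q : isometric (tens qzero q) qzero.
Proof.
apply: (@rep_isom _ _ _ _ _ _ (fun x : 'I_0 * 'I_(qdim q) => x.1)).
- exact: rep_tens (rep_self _) (rep_self _).
- exact: rep_self.
- by exists (fun i : 'I_0 => let: Ordinal _ h := i in False_rect _ (notF h)); case=> // -[].
- by case=> -[].
Qed.

Lemma tensDl q1 q2 q3 :
  isometric (tens (orth q1 q2) q3) (orth (tens q1 q3) (tens q2 q3)).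
Proof.
pose g (x : ('I_(qdim q1) + 'I_(qdim q2)) * 'I_(qdim q3)) :=
  match x.1 with inl i => inl (i, x.2) | inr i => inr (i, x.2) end.
apply: (@rep_isom _ _ _ _ _ _ g).
- exact: rep_tens (rep_orth (rep_self _) (rep_self _)) (rep_self _).
- exact: rep_orth (rep_tens (rep_self _) (rep_self _)) (rep_tens (rep_self _) (rep_self _)).
- exists (fun x => match x with inl p => (inl p.1, p.2) | inr p => (inr p.1, p.2) end).
    by case=> -[].
  by case=> -[].
- by case=> -[i|i] i' [[j|j] j']; rewrite /prodb /= ?mul0r.
Qed.

End Forms.

Section IsoClasses.
Variable K : fieldType.

Let isob (q q' : qform K) := `[< isometric q q' >].
Fact isob_refl : reflexive isob.
Proof. by move=> q; apply/asboolP/isometric_refl. Qed.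
Fact isob_sym : symmetric isob.
Proof. by move=> q q'; apply/asboolP/asboolP => /isometric_sym. Qed.
Fact isob_trans : transitive isob.
Proof.
move=> q2 q1 q3 /asboolP H /asboolP H'; apply/asboolP.
exact: isometric_trans H H'.
Qed.
Definition iso_equiv := EquivRel isob isob_refl isob_sym isob_trans.

(* The semiring of isometry classes of nondegenerate quadratic forms. *)
Definition isoclass := {eq_quot iso_equiv}.
HB.instance Definition _ := Choice.on isoclass.

Definition cls (q : qform K) : isoclass := \pi_isoclass q.

Lemma clsP q q' : cls q = cls q' <-> isometric q q'.
Proof.
split=> [/eqmodP/asboolP //|h].
by apply/eqmodP/asboolP.
Qed.

Lemma cls_repr (x : isoclass) : cls (repr x) = x.
Proof. exact: reprK. Qed.

Lemma repr_cls q : isometric (repr (cls q)) q.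
Proof. by apply/clsP; rewrite cls_repr. Qed.

Definition iso_add (x y : isoclass) := cls (orth (repr x) (repr y)).
Definition iso_mul (x y : isoclass) := cls (tens (repr x) (repr y)).

Lemma iso_addE q q' : iso_add (cls q) (cls q') = cls (orth q q').
Proof. by apply/clsP; apply: orth_isom; apply: repr_cls. Qed.
Lemma iso_mulE q q' : iso_mul (cls q) (cls q') = cls (tens q q').
Proof. by apply/clsP; apply: tens_isom; apply: repr_cls. Qed.

Lemma iso_addA : associative iso_add.
Proof.
move=> x y z; rewrite -[x]cls_repr -[y]cls_repr -[z]cls_repr !iso_addE.
by apply/clsP/orthA.
Qed.
Lemma iso_addC : commutative iso_add.
Proof. by move=> x y; apply/clsP/orthC. Qed.
Lemma iso_add0 : left_id (cls (qzero K)) iso_add.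
Proof.
by move=> x; rewrite -[x]cls_repr !iso_addE; apply/clsP/orth0.
Qed.
HB.instance Definition _ :=
  GRing.isNmodule.Build isoclass iso_addA iso_addC iso_add0.

Lemma iso_mulA : associative iso_mul.
Proof.
move=> x y z; rewrite -[x]cls_repr -[y]cls_repr -[z]cls_repr !iso_mulE.
by apply/clsP/tensA.
Qed.
Lemma iso_mulC : commutative iso_mul.
Proof. by move=> x y; apply/clsP/tensC. Qed.
Lemma iso_mul1 : left_id (cls (diag1 (Kone K))) iso_mul.
Proof.
by move=> x; rewrite -[x]cls_repr !iso_mulE; apply/clsP/tens1.
Qed.
Lemma iso_mulDl : left_distributive iso_mul iso_add.
Proof.
move=> x y z; rewrite -[x]cls_repr -[y]cls_repr -[z]cls_repr.
by rewrite !(iso_mulE, iso_addE); apply/clsP/tensDl.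
Qed.
Lemma iso_mul0 : left_zero (cls (qzero K)) iso_mul.
Proof.
by move=> x; rewrite -[x]cls_repr !iso_mulE; apply/clsP/tens0.
Qed.
HB.instance Definition _ := GRing.Nmodule_isComPzSemiRing.Build isoclass
  iso_mulA iso_mulC iso_mul1 iso_mulDl iso_mul0.

Lemma clsD q q' : cls q + cls q' = cls (orth q q').
Proof. exact: iso_addE. Qed.
Lemma clsM q q' : cls q * cls q' = cls (tens q q').
Proof. exact: iso_mulE. Qed.

Definition iso_dim (x : isoclass) : nat := qdim (repr x).
Lemma iso_dimE q : iso_dim (cls q) = qdim q.
Proof. exact/isometric_qdim/repr_cls. Qed.

Definition iso_ext d (x : isoclass) : isoclass := cls (ext d (repr x)).
Lemma iso_extE d q : iso_ext d (cls q) = cls (ext d q).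
Proof. by apply/clsP; apply: ext_isom; apply: repr_cls. Qed.

End IsoClasses.

(* Grothendieck ring of a commutative semiring: formal differences x.1 - x.2. *)
Section Grothendieck.
Variable S : comPzSemiRingType.
Implicit Types x y z : S * S.

Definition geq x y : Prop := exists c, x.1 + y.2 + c = y.1 + x.2 + c.
Let geqb x y := `[< geq x y >].
Fact geqb_refl : reflexive geqb.
Proof. by move=> x; apply/asboolP; exists 0. Qed.
Fact geqb_sym : symmetric geqb.
Proof. by move=> x y; apply/asboolP/asboolP => -[c E]; exists c. Qed.
Fact geqb_trans : transitive geqb.
Proof.
move=> y x z /asboolP[c E] /asboolP[d F]; apply/asboolP.
exists (y.1 + y.2 + c + d).
have -> : x.1 + z.2 + (y.1 + y.2 + c + d) = (x.1 + y.2 + c) + (y.1 + z.2 + d).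
  by ring.
by rewrite E F; ring.
Qed.
Definition geq_equiv := EquivRel geqb geqb_refl geqb_sym geqb_trans.

Definition groth := {eq_quot geq_equiv}.
HB.instance Definition _ := Choice.on groth.

Definition gcls x : groth := \pi_groth x.

Lemma gclsP x y : gcls x = gcls y <-> geq x y.
Proof.
split=> [/eqmodP/asboolP //|h].
by apply/eqmodP/asboolP.
Qed.

Lemma gcls_repr (a : groth) : gcls (repr a) = a.
Proof. exact: reprK. Qed.
Lemma repr_gcls x : geq (repr (gcls x)) x.
Proof. by apply/gclsP; rewrite gcls_repr. Qed.

Definition gadd (a b : groth) : groth :=
  gcls ((repr a).1 + (repr b).1, (repr a).2 + (repr b).2).
Definition gopp (a : groth) : groth := gcls ((repr a).2, (repr a).1).
Definition gmul (a b : groth) : groth :=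
  gcls ((repr a).1 * (repr b).1 + (repr a).2 * (repr b).2,
        (repr a).1 * (repr b).2 + (repr a).2 * (repr b).1).

Lemma gaddE x y : gadd (gcls x) (gcls y) = gcls (x.1 + y.1, x.2 + y.2).
Proof.
apply/gclsP; have [c E] := repr_gcls x; have [d F] := repr_gcls y.
exists (c + d) => /=; set x' := repr _ in E *; set y' := repr _ in F *.
have -> : x'.1 + y'.1 + (x.2 + y.2) + (c + d) =
          (x'.1 + x.2 + c) + (y'.1 + y.2 + d) by ring.
by rewrite E F; ring.
Qed.

Lemma goppE x : gopp (gcls x) = gcls (x.2, x.1).
Proof.
apply/gclsP; have [c E] := repr_gcls x; exists c => /=.
by rewrite [_ + x.1]addrC -E [x.2 + _]addrC.
Qed.

Lemma gmulE x y :
  gmul (gcls x) (gcls y) = gcls (x.1 * y.1 + x.2 * y.2, x.1 * y.2 + x.2 * y.1).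
Proof.
transitivity (gcls (x.1 * (repr (gcls y)).1 + x.2 * (repr (gcls y)).2,
                    x.1 * (repr (gcls y)).2 + x.2 * (repr (gcls y)).1)).
  apply/gclsP; have [c E] := repr_gcls x.
  set y' := repr (gcls y); case: (repr (gcls x)) E => a b /= E.
  exists (c * (y'.1 + y'.2)); rewrite /=.
  transitivity ((a + x.2 + c) * y'.1 + (x.1 + b + c) * y'.2); first by ring.
  by rewrite E -[in X in _ + X]E; ring.
apply/gclsP; have [c E] := repr_gcls y; case: (repr (gcls y)) E => a b /= E.
exists (c * (x.1 + x.2)); rewrite /=.
transitivity ((a + y.2 + c) * x.1 + (y.1 + b + c) * x.2); first by ring.
by rewrite E -[in X in _ + X]E; ring.
Qed.

Lemma gaddA : associative gadd.
Proof.
move=> a b c; rewrite -[a]gcls_repr -[b]gcls_repr -[c]gcls_repr !gaddE.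
by rewrite /= !addrA.
Qed.
Lemma gaddC : commutative gadd.
Proof. by move=> a b; rewrite /gadd addrC [X in (_, X)]addrC. Qed.
Lemma gadd0 : left_id (gcls (0, 0)) gadd.
Proof.
by move=> a; rewrite -[a]gcls_repr gaddE /= !add0r -surjective_pairing.
Qed.
Lemma gaddN : left_inverse (gcls (0, 0)) gopp gadd.
Proof.
move=> a; rewrite -[a]gcls_repr goppE gaddE; apply/gclsP; exists 0 => /=.
by ring.
Qed.
HB.instance Definition _ := GRing.isZmodule.Build groth gaddA gaddC gadd0 gaddN.

Lemma gmulA : associative gmul.
Proof.
move=> a b c; rewrite -[a]gcls_repr -[b]gcls_repr -[c]gcls_repr !gmulE /=.
by congr gcls; congr pair; ring.
Qed.
Lemma gmulC : commutative gmul.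
Proof. by move=> a b; rewrite /gmul; congr gcls; congr pair; ring. Qed.
Lemma gmul1 : left_id (gcls (1, 0)) gmul.
Proof.
move=> a; rewrite -[a]gcls_repr gmulE /= !mul1r !mul0r !addr0.
by rewrite -surjective_pairing.
Qed.
Lemma gmulDl : left_distributive gmul gadd.
Proof.
move=> a b c; rewrite -[a]gcls_repr -[b]gcls_repr -[c]gcls_repr.
rewrite !(gmulE, gaddE) /=.
by congr gcls; congr pair; ring.
Qed.
HB.instance Definition _ := GRing.Zmodule_isComPzRing.Build groth
  gmulA gmulC gmul1 gmulDl.

Definition ginj (s : S) : groth := gcls (s, 0).

Lemma gcls_sub x : gcls x = ginj x.1 - ginj x.2.
Proof.
rewrite -[RHS]/(gadd (ginj x.1) (gopp (ginj x.2))) goppE gaddE /=.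
by rewrite addr0 add0r -surjective_pairing.
Qed.

End Grothendieck.

Definition GW (K : fieldType) : comPzRingType := groth (isoclass K).

Section FormalPowerSeries.
Variable R : comPzRingType.
Implicit Types f g : nat -> R.

(* The power series with coefficients f is f 0 + f 1 t + f 2 t^2 + ... *)
Definition fps_one : nat -> R := fun d => (d == 0%N)%:R.
Definition fps_mul f g : nat -> R :=
  fun d => \sum_(i < d.+1) f i * g (d - i)%N.
Definition fps_exp f m : nat -> R := iter m (fps_mul f) fps_one.

(* Coefficients d, ..., 0 of the inverse g of f, where u is the inverse of f 0:
   g_0 = u and g_(d+1) = - u * \sum_(i <= d) f_(i+1) g_(d-i). *)
Fixpoint fps_inv_coefs (u : R) f d : seq R :=
  if d is d'.+1 then
    let s := fps_inv_coefs u f d' in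
    - u * (\sum_(i < d) f i.+1 * nth 0 s i) :: s
  else [:: u].
Definition fps_inv (u : R) f : nat -> R := fun d => head 0 (fps_inv_coefs u f d).

Lemma fps_inv_coefsE u f d :
  fps_inv_coefs u f d = rev (mkseq (fps_inv u f) d.+1).
Proof.
elim: d => // d IH; rewrite /mkseq -[in iota _ _]addn1 iotaD map_cat rev_cat /=.
by rewrite -IH.
Qed.

Lemma mul_fps_inv u f : f 0%N * u = 1 -> fps_mul f (fps_inv u f) =1 fps_one.
Proof.
move=> fu [|d]; first by rewrite /fps_mul big_ord1.
rewrite /fps_mul big_ord_recl subn0 /fps_one /= {1}/fps_inv /=.
rewrite mulrA mulrN fu mulN1r addrC; apply/eqP; rewrite subr_eq0; apply/eqP.
apply: eq_bigr => i _; rewrite subSS fps_inv_coefsE nth_rev ?size_mkseq //.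
by rewrite nth_mkseq ?subSS // ltnS leq_subr.
Qed.

(* f (g t), where the sum is finite as g is assumed to have no constant term. *)
Definition fps_comp f (g : nat -> R) : nat -> R :=
  fun d => \sum_(m < d.+1) f m * fps_exp g m d.

End FormalPowerSeries.

(* (1 + c t)^a = \sum_i a (a - 1) ... (a - i + 1) / i! c^i t^i. *)
Definition fps_binomial (a c : rat) : nat -> rat :=
  fun i => (\prod_(j < i) (a - j%:R)) / i`!%:R * c ^+ i.

(* pi_n(t) = 1 - 2 / (1 + (1 + 2^n t)^(1 / 2^(n-1))), for n >= 1. *)
Definition pi_series (n : nat) : nat -> rat := fun d =>
  fps_one _ d -
  2 * fps_inv 2^-1
        (fun i => fps_one _ i + fps_binomial (2 ^+ n.-1)^-1 (2 ^+ n) i) d.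

(* These rationals are integers, so that numq only changes their type. *)
Definition pi_coef (n d : nat) : int := numq (pi_series n d).

Section GrothendieckWitt.
Variable K : fieldType.
Implicit Types x y : GW K.

Definition diag_class (a : Kstar K) : GW K := ginj (cls (diag1 a)).

Definition pfister1 (a : Kstar K) : GW K := diag_class (Kone K) - diag_class a.
Definition pfister n (a : n.-tuple (Kstar K)) : GW K :=
  \prod_(i < n) pfister1 (tnth a i).
Definition Pf (n : nat) x : Prop := exists a : n.-tuple (Kstar K), x = pfister a.

(* vdim and lambda are computed on a representation of x as a difference of two
   isometry classes; they do not depend on it, the dimension being additive and
   lambda_t turning orthogonal sums into products. *)
Definition vdim x : int := (iso_dim (repr x).1)%:Z - (iso_dim (repr x).2)%:Z.

Definition lambda_iso (q : isoclass K) : nat -> GW K :=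
  fun d => ginj (iso_ext d q).
Definition lambda x : nat -> GW K :=
  fps_mul (lambda_iso (repr x).1) (fps_inv 1 (lambda_iso (repr x).2)).

(* Coefficient of t^d in lambda_(pi_n(t))(x). *)
Definition pi_op (n d : nat) x : GW K :=
  fps_comp (lambda x) (fun i => (pi_coef n i)%:~R) d.

(* n-th power of the ideal of elements of virtual dimension 0; it is identified
   with the n-th power of the fundamental ideal of the Witt ring. *)
Definition Ihat x : Prop := vdim x = 0.
Definition Ihat_pow (n : nat) x : Prop :=
  exists (m : nat) (c : 'I_m -> GW K) (y : 'I_m -> 'I_n -> GW K),
    (forall i j, Ihat (y i j)) /\ x = \sum_i c i * \prod_j y i j.

End GrothendieckWitt.

Section BaseChange.
Variables (K L : fieldType) (j : {rmorphism K -> L}).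

Fact qmap_sym (q : qform K) : (map_mx j (gram q))^T = map_mx j (gram q).
Proof. by rewrite map_trmx gram_sym. Qed.
Fact qmap_unit (q : qform K) : map_mx j (gram q) \in unitmx.
Proof. by rewrite map_unitmx gram_unit. Qed.
Definition qmap (q : qform K) : qform L := QForm (qmap_sym q) (qmap_unit q).

Lemma qmap_isom (q q' : qform K) : isometric q q' -> isometric (qmap q) (qmap q').
Proof.
move=> [P [P' [PP' P'P E]]]; exists (map_mx j P), (map_mx j P'); split.
- by rewrite -map_mxM PP' map_mx1.
- by rewrite -map_mxM P'P map_mx1.
- by rewrite /= map_trmx -!map_mxM E.
Qed.

Definition iso_map (x : isoclass K) : isoclass L := cls (qmap (repr x)).
Lemma iso_mapE q : iso_map (cls q) = cls (qmap q).
Proof. by apply/clsP; apply: qmap_isom; apply: repr_cls. Qed.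

Lemma iso_mapD (x y : isoclass K) : iso_map (x + y) = iso_map x + iso_map y.
Proof.
rewrite -[x]cls_repr -[y]cls_repr clsD !iso_mapE clsD; apply/clsP.
set q := repr x; set q' := repr y.
apply: (@isometric_bij _ (qmap (orth q q')) (orth (qmap q) (qmap q')) id).
  by exists id.
by move=> a b; rewrite /= map_block_mx !map_mx0.
Qed.

Definition gw_map (x : GW K) : GW L :=
  gcls (iso_map (repr x).1, iso_map (repr x).2).

Lemma gw_mapE (x : isoclass K * isoclass K) :
  gw_map (gcls x) = gcls (iso_map x.1, iso_map x.2).
Proof.
apply/gclsP; have [c E] := repr_gcls x; exists (iso_map c).
by rewrite /= -!iso_mapD E.
Qed.

End BaseChange.

Lemma iso_dimD (K : fieldType) (x y : isoclass K) :
  iso_dim (x + y) = (iso_dim x + iso_dim y)%N.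
Proof. by rewrite -[x]cls_repr -[y]cls_repr clsD !iso_dimE. Qed.

Lemma vdimE (K : fieldType) (x : isoclass K * isoclass K) :
  vdim (gcls x) = (iso_dim x.1)%:Z - (iso_dim x.2)%:Z.
Proof.
have [c /(congr1 (@iso_dim K))] := repr_gcls x; rewrite !iso_dimD => E.
rewrite /vdim; apply/eqP; rewrite subr_eq addrAC eq_sym subr_eq -!PoszD eqz_nat.
by rewrite -(eqn_add2r (iso_dim c)) -E addnC.
Qed.

Record fext (k : fieldType) := FExt {
  fext_field :> fieldType;
  fext_emb : {rmorphism k -> fext_field}
}.

Section Extensions.
Variable k : fieldType.
Implicit Types K L M : fext k.

Record fhom K L := FHom {
  fhom_mor :> {rmorphism K -> L};
  fhom_emb : forall a, fhom_mor (fext_emb K a) = fext_emb L a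
}.

Definition fhom_id K : fhom K K :=
  @FHom K K [the {rmorphism K -> K} of idfun] (fun => erefl).

Fact fhom_comp_emb K L M (h : fhom L M) (g : fhom K L) a :
  [the {rmorphism K -> M} of h \o g] (fext_emb K a) = fext_emb M a.
Proof. by rewrite /= !fhom_emb. Qed.
Definition fhom_comp K L M (h : fhom L M) (g : fhom K L) : fhom K M :=
  FHom (fhom_comp_emb h g).

(* A functor from field extensions of k to separated filtered commutative
   rings. *)
Record filt_functor := FiltFunctor {
  fobj :> fext k -> comPzRingType;
  fmap : forall K L, fhom K L -> {rmorphism fobj K -> fobj L};
  fmap_id : forall K (x : fobj K), fmap (fhom_id K) x = x;
  fmap_comp : forall K L M (h : fhom L M) (g : fhom K L) (x : fobj K),
    fmap (fhom_comp h g) x = fmap h (fmap g x);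
  fil : forall K, nat -> fobj K -> Prop;
  fil_0 : forall K (x : fobj K), fil 0 x;
  fil_S : forall K d (x : fobj K), fil d.+1 x -> fil d x;
  fil_zero : forall K d, fil d (0 : fobj K);
  fil_sub : forall K d (x y : fobj K), fil d x -> fil d y -> fil d (x - y);
  fil_mul : forall K d e (x y : fobj K),
    fil d x -> fil e y -> fil (d + e) (x * y);
  fil_map : forall K L (h : fhom K L) d (x : fobj K),
    fil d x -> fil d (fmap h x);
  fil_cap : forall K (x : fobj K), (forall d, fil d x) -> x = 0
}.

Variable A : filt_functor.

(* alpha is an invariant over K of the subfunctor P of GW with values in A: only
   the values alpha L j x with P L x, for j : K -> L, are relevant. *)
Definition is_invariant K (P : forall L, GW L -> Prop)
    (alpha : forall L, fhom K L -> GW L -> A L) : Prop :=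
  forall L M (j : fhom K L) (h : fhom L M) (x : GW L),
    P L x -> alpha M (fhom_comp h j) (gw_map h x) = fmap A h (alpha L j x).

(* {a_1, ..., a_n} *)
Definition symb (f : nat -> forall K, GW K -> A K) K n
    (a : n.-tuple (Kstar K)) : A K :=
  \prod_(i < n) f 1%N K (pfister1 (tnth a i)).

(* The morphisms f_n, n >= 1, seen as maps on GW K of which only the values on
   Ihat^n are relevant; they are determined by f_1, as Pf_n generates Ihat^n. *)
Record pfister_family := PfisterFamily {
  pf_f : nat -> forall K, GW K -> A K;
  pf_f1_fil : forall K (x : GW K), Ihat x -> fil 1 (pf_f 1 x);
  pf_f1_nat : forall K L (h : fhom K L) (x : GW K),
    Ihat x -> pf_f 1 (gw_map h x) = fmap A h (pf_f 1 x);
  pf_inj : forall K n (a b : n.-tuple (Kstar K)),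
    pfister a = pfister b <-> symb pf_f a = symb pf_f b;
  pf_f_pfister : forall n, (0 < n)%N -> forall K (a : n.-tuple (Kstar K)),
    pf_f n (pfister a) = symb pf_f a;
  pf_f_add : forall n, (0 < n)%N -> forall K (x y : GW K),
    Ihat_pow n x -> Ihat_pow n y -> pf_f n (x + y) = pf_f n x + pf_f n y;
  pf_f_fil : forall n, (0 < n)%N -> forall K (x : GW K),
    Ihat_pow n x -> fil n (pf_f n x);
  pf_detect : forall K d (x : A K),
    (forall L (h : fhom K L) (a : Kstar L),
       fil d.+1 (pf_f 1 (pfister1 a) * fmap A h x)) -> fil d x;
  pf_inv : forall K n, (0 < n)%N ->
    forall alpha : forall L, fhom K L -> GW L -> A L,
    is_invariant (fun L => @Pf L n) alpha ->
    exists! c : A K * A K, forall L (j : fhom K L) (phi : GW L), Pf n phi ->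
      alpha L j phi = fmap A j c.1 + fmap A j c.2 * pf_f n phi
}.

(* pi_n^d maps Ihat^n to Ihat^(nd), so only relevant values of f_(nd) are used
   on Ihat^n. *)
Definition pf_div (f : pfister_family) (n d : nat) K (x : GW K) : A K :=
  if d is 0 then 1 else pf_f f (n * d) (pi_op n d x).

Definition pf_m1 (f : pfister_family) K : A K := pf_f f 1 (pfister1 (Kopp1 K)).

End Extensions.

(* Main.v *)
Require Import Defs.
From HB Require Import structures.
From mathcomp Require Import all_boot all_order all_algebra.
From mathcomp Require Import perm ring zify boolp.

Set Implicit Arguments.
Unset Strict Implicit.
Unset Printing Implicit Defensive.

Import Order.TTheory GRing.Theory Num.Theory.
Local Open Scope ring_scope.

(** Write F_x for the series sum_d f_n^d(x) t^d and c for {-1}^n. The argument is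
that x |-> F_x turns adding a Pfister element phi into multiplication by
1 + {phi} t, where {phi} = f_n(phi) satisfies {phi}^2 = c {phi}, and that the
product formula is stable under multiplication and division by such factors.

The formula says that F_x(X) F_x(Y) = F_x(X + Y + c X Y): the multinomial
coefficient with its power of c is the coefficient of X^s Y^t in
(X + Y + c X Y)^d. If F = 1 + y t with y^2 = c y this is immediate, and both
sides are multiplicative in F. On coefficients, the stability is a Pascal
recursion for the multinomial coefficients ([weightS], [defect_mulshift],
[defect0_mulshift]), which avoids series in two variables.

It remains to see that I^n is generated by Pfister elements and that F behaves
as claimed.
- Quadratic forms are diagonalisable as the characteristic is not 2
  ([split_qform], [iso_ind]). Hence an element of dimension 0 is a combination
  of the <<a>>, and <a><<b>> = <<ab>> - <<a>> makes the group generated by the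
  n-fold Pfister elements an ideal: it is I^n ([Ihat_pow_span]).
- The exterior powers of <a> + q split as those of q and <a> times those of q
  ([ext_orth_diag1]), whence lambda_t turns sums into products ([lambdaD]).
- For an n-fold Pfister element phi, lambda_t(phi) = 1 + phi h(t), where
  1 + 2^n h = ((1 + t) / (1 - t))^(2^(n-1)) ([lambda_pfister_seq]). The series
  pi_n is the inverse of h for composition ([subst_pfister_pi]), in particular
  integral ([pi_series_int]), and so lambda_(pi_n(t))(phi) = 1 + phi t. This
  gives pi_n^(d+1)(x + phi) = pi_n^(d+1)(x) + phi pi_n^d(x)
  ([pi_opD_pfister]), and applying f_(n(d+1)) gives the claim on F
  ([pf_div_add_pfister]).
- The identity {phi}^2 = c {phi} comes from <<a, a>> = <<a, -1>>
  ([pfister1_sq], [pf_f_sq]). *)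

(** * Formal power series *)

(** A copy of the type of sequences, to carry the convolution product rather than
    the pointwise one. *)
Definition fps (R : comPzRingType) := nat -> R.

Section FpsRing.
Variable R : comPzRingType.
Implicit Types f g h : fps R.

HB.instance Definition _ := gen_eqMixin (fps R).
HB.instance Definition _ := gen_choiceMixin (fps R).

Lemma fpsP f g : f =1 g -> f = g.
Proof. by move=> fg; apply: funext. Qed.

Definition fps_add f g : fps R := fun d => f d + g d.
Definition fps_opp f : fps R := fun d => - f d.
Definition fps_zero : fps R := fun _ => 0.

Fact fps_addA : associative fps_add.
Proof. by move=> f g h; apply: fpsP => d; apply: addrA. Qed.
Fact fps_addC : commutative fps_add.
Proof. by move=> f g; apply: fpsP => d; apply: addrC. Qed.
Fact fps_add0 : left_id fps_zero fps_add.
Proof. by move=> f; apply: fpsP => d; apply: add0r. Qed.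
Fact fps_addN : left_inverse fps_zero fps_opp fps_add.
Proof. by move=> f; apply: fpsP => d; apply: addNr. Qed.
HB.instance Definition _ :=
  GRing.isZmodule.Build (fps R) fps_addA fps_addC fps_add0 fps_addN.

Lemma fpsD f g d : (f + g) d = f d + g d. Proof. by []. Qed.
Lemma fpsN f d : (- f) d = - f d. Proof. by []. Qed.

Definition fps_shift f : fps R := fun d => f d.+1.

Lemma fps_mul0 f g : fps_mul f g 0 = f 0%N * g 0%N.
Proof. by rewrite /fps_mul big_ord1. Qed.

(** Peeling off the constant term of the left factor; identities between
    products then follow by induction on the degree, for all series at once. *)
Lemma fps_mulS f g d :
  fps_mul f g d.+1 = f 0%N * g d.+1 + fps_mul (fps_shift f) g d.
Proof. by rewrite /fps_mul big_ord_recl. Qed.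

Fact fps_mulC : commutative (@fps_mul R : fps R -> fps R -> fps R).
Proof.
move=> f g; apply: fpsP => d; rewrite /fps_mul (reindex_inj rev_ord_inj) /=.
by apply: eq_bigr => i _; rewrite subSS subKn ?leq_ord // mulrC.
Qed.

Fact fps_mulDl : left_distributive (@fps_mul R : fps R -> fps R -> fps R) +%R.
Proof.
move=> f g h; apply: fpsP => d; rewrite fpsD /fps_mul -big_split /=.
by apply: eq_bigr => i _; rewrite fpsD mulrDl.
Qed.

Lemma fps_mulZ (a : R) f g d : fps_mul (fun i => a * f i) g d = a * fps_mul f g d.
Proof. by rewrite /fps_mul big_distrr /=; apply: eq_bigr => i _; rewrite mulrA. Qed.

Lemma fps_shiftM f g : fps_shift (fps_mul f g) =
  ((fun d => f 0%N * fps_shift g d) : fps R) + fps_mul (fps_shift f) g :> fps R.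
Proof. by apply: fpsP => d; rewrite /fps_shift fps_mulS. Qed.

Fact fps_mulA : associative (@fps_mul R : fps R -> fps R -> fps R).
Proof.
move=> f g h; apply: fpsP => d; elim: d f g h => [|d IH] f g h.
  by rewrite !fps_mul0 mulrA.
rewrite fps_mulS IH [in RHS]fps_mulS fps_mul0 fps_shiftM fps_mulDl fpsD.
by rewrite fps_mulZ fps_mulS mulrDr !addrA mulrA.
Qed.

Fact fps_mul1 : left_id (@fps_one R) (@fps_mul R : fps R -> fps R -> fps R).
Proof.
move=> f; apply: fpsP => d; rewrite /fps_mul big_ord_recl subn0 /fps_one mul1r.
by rewrite big1 ?addr0 // => i _; rewrite mul0r.
Qed.

HB.instance Definition _ := GRing.Zmodule_isComPzRing.Build (fps R)
  fps_mulA fps_mulC fps_mul1 fps_mulDl.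

Lemma fpsM0 f g : (f * g) 0%N = f 0%N * g 0%N. Proof. exact: fps_mul0. Qed.
Lemma fpsMS f g d : (f * g) d.+1 = f 0%N * g d.+1 + (fps_shift f * g) d.
Proof. exact: fps_mulS. Qed.
Lemma fpsM f g d : (f * g) d = \sum_(i < d.+1) f i * g (d - i)%N.
Proof. by []. Qed.
Lemma fps1 d : (1 : fps R) d = (d == 0%N)%:R. Proof. by []. Qed.
Lemma fps_expE f m : fps_exp f m = f ^+ m :> fps R.
Proof. by elim: m => // m IH; rewrite exprS -IH. Qed.

Definition fpsC (a : R) : fps R := fun d => if d is 0 then a else 0.
Definition fpsX : fps R := fun d => (d == 1)%:R.

Lemma fpsCM a f d : (fpsC a * f) d = a * f d.
Proof.
rewrite fpsM big_ord_recl subn0 big1 ?addr0 // => i _.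
by rewrite /fpsC mul0r.
Qed.
Lemma fpsC1 : fpsC 1 = 1. Proof. by apply: fpsP => -[]. Qed.
Lemma fpsCD a b : fpsC (a + b) = fpsC a + fpsC b.
Proof. by apply: fpsP => -[//|d]; rewrite fpsD addr0. Qed.
Lemma fpsCN a : fpsC (- a) = - fpsC a.
Proof. by apply: fpsP => -[//|d]; rewrite fpsN oppr0. Qed.
Lemma fpsC_mul a b : fpsC (a * b) = fpsC a * fpsC b.
Proof. by apply: fpsP => -[|d]; rewrite fpsCM //= mulr0. Qed.
Lemma fpsC_nat m : fpsC m%:R = m%:R.
Proof.
elim: m => [|m IH]; last by rewrite -!natr1 fpsCD IH fpsC1.
by apply: fpsP => -[].
Qed.

Lemma fpsXM0 f : (fpsX * f) 0%N = 0. Proof. by rewrite fpsM0 mul0r. Qed.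
Lemma fpsXMS f d : (fpsX * f) d.+1 = f d.
Proof.
rewrite fpsMS mul0r add0r; have -> : fps_shift fpsX = 1 by apply: fpsP => -[].
by rewrite mul1r.
Qed.

Lemma fps_inv_mul u f : f 0%N * u = 1 -> f * fps_inv u f = 1.
Proof. by move=> /mul_fps_inv fu; apply: fpsP => d; apply: fu. Qed.

(** R may have zero divisors, but a series with constant term 1 is
    invertible. *)
Lemma fps_mulI f g h : f 0%N = 1 -> f * g = f * h -> g = h.
Proof.
move=> f1 E; have fV : f * fps_inv 1 f = 1 by apply: fps_inv_mul; rewrite f1 mulr1.
by rewrite -[g]mul1r -[h]mul1r -fV (mulrC f) -!mulrA E.
Qed.

Lemma fps_expr_lt g m d : g 0%N = 0 -> (d < m)%N -> (g ^+ m) d = 0.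
Proof.
move=> g0; elim: m d => // m IH d dm.
rewrite exprS fpsM big1 // => -[[|i] i_d] _ /=; first by rewrite g0 mul0r.
rewrite IH ?mulr0 //; case: d i_d dm => // d _ dm.
by rewrite subSS (leq_ltn_trans (leq_subr _ _)).
Qed.

Definition fps_subst f g : fps R := fps_comp f g.

(** Since g has no constant term, g ^+ m starts in degree m, and the sum can be
    cut at any level above d. *)
Lemma fps_substE f g d N : g 0%N = 0 -> (d < N)%N ->
  fps_subst f g d = \sum_(m < N) f m * (g ^+ m) d.
Proof.
move=> g0 dN; rewrite /fps_subst /fps_comp [RHS](bigID (fun m : 'I_N => (m < d.+1)%N)) /=.
rewrite [X in _ = _ + X]big1 ?addr0; last first.
  by move=> m; rewrite -leqNgt => dm; rewrite fps_expr_lt ?mulr0.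
rewrite (big_ord_widen N (fun m => f m * fps_exp g m d)) //.
by apply: eq_bigr => i _; rewrite fps_expE.
Qed.

Lemma fps_subst_rec f g : g 0%N = 0 ->
  fps_subst f g = fpsC (f 0%N) + g * fps_subst (fps_shift f) g.
Proof.
move=> g0; apply: fpsP => d; rewrite (@fps_substE f g d d.+2) // big_ord_recl.
rewrite fpsD expr0; congr (_ + _).
  by rewrite fps1; case: d => [|d]; rewrite ?mulr1 ?mulr0.
rewrite fpsM; under [RHS]eq_bigr => i _.
  rewrite (@fps_substE _ g (d - i) d.+1) //; last by rewrite ltnS leq_subr.
  rewrite big_distrr /=; over.
rewrite exchange_big /=; apply: eq_bigr => m _.
rewrite /bump /= add1n exprS fpsM big_distrr /=.
by apply: eq_bigr => i _; rewrite mulrCA.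
Qed.

Lemma fps_substD f1 f2 g : fps_subst (f1 + f2) g = fps_subst f1 g + fps_subst f2 g.
Proof.
apply: fpsP => d; rewrite fpsD /fps_subst /fps_comp -big_split /=.
by apply: eq_bigr => i _; rewrite fpsD mulrDl.
Qed.

Lemma fps_substC a g : fps_subst (fpsC a) g = fpsC a.
Proof.
apply: fpsP => d; rewrite /fps_subst /fps_comp big_ord_recl big1 ?addr0.
  by rewrite /= /fps_one; case: d => [|d]; rewrite ?mulr1 ?mulr0.
by move=> i _; rewrite /fpsC mul0r.
Qed.

Lemma fps_subst1 g : fps_subst 1 g = 1.
Proof. by rewrite -fpsC1 fps_substC. Qed.

Lemma fps_substZ a f g d : fps_subst (fun i => a * f i) g d = a * fps_subst f g d.
Proof.
by rewrite /fps_subst /fps_comp big_distrr /=; apply: eq_bigr => i _; rewrite mulrA.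
Qed.

(** By [fps_subst_rec] the difference of the two sides is g times the same
    difference for a shifted series; as g has no constant term, its coefficient
    of degree d only involves lower degrees. *)
Lemma fps_substM f1 f2 g : g 0%N = 0 ->
  fps_subst (f1 * f2) g = fps_subst f1 g * fps_subst f2 g.
Proof.
move=> g0; apply: fpsP => d; elim/ltn_ind: d f1 f2 => d IH f1 f2.
have -> : fps_subst (f1 * f2) g = fpsC (f1 0%N) * fps_subst f2 g +
    g * fps_subst (fps_shift f1 * f2) g.
  rewrite fps_subst_rec // fpsM0 [in RHS]fps_subst_rec // mulrDr -fpsC_mul -addrA.
  congr (_ + _); rewrite mulrCA -mulrDr; congr (_ * _).
  rewrite [fps_shift _]fps_shiftM fps_substD; congr (_ + _).
  by apply: fpsP => e; rewrite fps_substZ fpsCM.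
rewrite [fps_subst f1 g]fps_subst_rec // mulrDl !fpsD; congr (_ + _).
rewrite -mulrA !fpsM; apply: eq_bigr => -[[|i] i_d] _ /=.
  by rewrite g0 !mul0r.
by rewrite IH //; case: d i_d {IH} => // d i_d; rewrite subSS ltnS leq_subr.
Qed.

Lemma fps_substX g : g 0%N = 0 -> fps_subst fpsX g = g.
Proof.
move=> g0; rewrite fps_subst_rec //; have -> : fps_shift fpsX = 1 by apply: fpsP => -[].
rewrite fps_subst1 mulr1; have -> : fpsC (fpsX 0%N) = 0 by apply: fpsP => -[].
by rewrite add0r.
Qed.

Lemma fps_substXn f g m : g 0%N = 0 -> fps_subst (f ^+ m) g = fps_subst f g ^+ m.
Proof. by move=> g0; elim: m => [|m IH]; rewrite ?fps_subst1 // !exprS fps_substM // IH. Qed.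

Lemma fps_substN f g : fps_subst (- f) g = - fps_subst f g.
Proof.
by apply/eqP; rewrite -addr_eq0 addrC -fps_substD subrr; apply/eqP/fpsP => d;
  rewrite /fps_subst /fps_comp big1 // => i _; rewrite mul0r.
Qed.

(** The series f (a t). *)
Definition twist (a : R) f : fps R := fun d => a ^+ d * f d.
Lemma twistM a f g : twist a (f * g) = twist a f * twist a g.
Proof.
apply: fpsP => d; rewrite /twist !fpsM big_distrr /=; apply: eq_bigr => i _.
by rewrite mulrACA -exprD subnKC // leq_ord.
Qed.
Lemma twistD a f g : twist a (f + g) = twist a f + twist a g.
Proof. by apply: fpsP => d; rewrite /twist !fpsD mulrDr. Qed.
Lemma twistN a f : twist a (- f) = - twist a f.
Proof. by apply: fpsP => d; rewrite /twist !fpsN mulrN. Qed.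
Lemma twistC a b : twist a (fpsC b) = fpsC b.
Proof. by apply: fpsP => -[|d]; rewrite /twist ?mul1r //= mulr0. Qed.
Lemma twist1 a : twist a 1 = 1.
Proof. by rewrite -fpsC1 twistC. Qed.
Lemma twistX a : twist a fpsX = fpsC a * fpsX.
Proof. by apply: fpsP => -[|[|d]]; rewrite fpsCM /twist /fpsX /= ?mulr0. Qed.

(** The derivation t d/dt, which unlike d/dt preserves degrees and so satisfies
    the product rule term by term. *)
Definition fps_theta f : fps R := fun d => d%:R * f d.
Lemma fps_thetaM f g : fps_theta (f * g) = fps_theta f * g + f * fps_theta g.
Proof.
apply: fpsP => d; rewrite fpsD /fps_theta !fpsM big_distrr -big_split /=.
apply: eq_bigr => i _; rewrite -{1}(subnKC (leq_ord i)) natrD.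
by rewrite mulrDl -mulrA [X in _ + X]mulrCA.
Qed.
Lemma fps_thetaXn f m : fps_theta (f ^+ m.+1) = m.+1%:R * f ^+ m * fps_theta f.
Proof.
elim: m => [|m IH]; first by rewrite expr0 expr1 !mul1r.
by rewrite exprS fps_thetaM IH -[in RHS]natr1 exprS; ring.
Qed.

End FpsRing.

Section FpsMap.
Variables (R S : comPzRingType) (j : {rmorphism R -> S}).
Definition fps_map (f : fps R) : fps S := fun d => j (f d).
Lemma fps_mapD f g : fps_map (f + g) = fps_map f + fps_map g.
Proof. by apply: fpsP => d; apply: rmorphD. Qed.
Lemma fps_mapN f : fps_map (- f) = - fps_map f.
Proof. by apply: fpsP => d; apply: rmorphN. Qed.
Lemma fps_mapC a : fps_map (fpsC a) = fpsC (j a).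
Proof. by apply: fpsP => -[//|d]; apply: rmorph0. Qed.
Lemma fps_map1 : fps_map 1 = 1.
Proof. by rewrite -fpsC1 fps_mapC rmorph1 fpsC1. Qed.
Lemma fps_mapX : fps_map (@fpsX R) = @fpsX S.
Proof. by apply: fpsP => d; apply: rmorph_nat. Qed.
Lemma fps_mapM f g : fps_map (f * g) = fps_map f * fps_map g.
Proof.
apply: fpsP => d; rewrite /fps_map fpsM rmorph_sum.
by apply: eq_bigr => i _; apply: rmorphM.
Qed.
Lemma fps_mapXn f m : fps_map (f ^+ m) = fps_map f ^+ m.
Proof. by elim: m => [|m IH]; rewrite ?fps_map1 // !exprS fps_mapM IH. Qed.
Lemma fps_map_nat m : fps_map m%:R = m%:R.
Proof. by rewrite -fpsC_nat fps_mapC rmorph_nat fpsC_nat. Qed.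
Lemma fps_map_subst f g : fps_map (fps_subst f g) = fps_subst (fps_map f) (fps_map g).
Proof.
apply: fpsP => d; rewrite /fps_map /fps_subst /fps_comp rmorph_sum.
apply: eq_bigr => i _; rewrite rmorphM; congr (_ * _).
by rewrite !fps_expE -fps_mapXn.
Qed.
End FpsMap.

(** * The series pi_n and its inverse *)

Lemma fps_binomial0 a c : fps_binomial a c 0 = 1.
Proof. by rewrite /fps_binomial big_ord0 fact0 expr0 mulr1n divr1 mulr1. Qed.

(** The differential equation (1 + c t) f' = a c f of f = (1 + c t)^a,
    multiplied by t. *)
Lemma fps_binomial_theta a c :
  (1 + fpsC c * @fpsX rat) * fps_theta (fps_binomial a c) =
  fpsC (a * c) * (@fpsX rat * fps_binomial a c).
Proof.
apply: fpsP => d; rewrite mulrDl mul1r -mulrA fpsD !fpsCM.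
case: d => [|d]; first by rewrite !fpsXM0 /fps_theta mul0r !mulr0 addr0.
rewrite !fpsXMS /fps_theta /fps_binomial big_ord_recr /= factS natrM exprS.
have d0 : (d.+1%:R : rat) != 0 by rewrite pnatr_eq0.
have f0 : (d`!%:R : rat) != 0 by rewrite pnatr_eq0 -lt0n fact_gt0.
rewrite -natr1 in d0 *; by field; rewrite f0 d0.
Qed.

(** By [fps_binomial_theta] the left-hand side V satisfies
    (1 + c t) t V' = c t V, a recursion that determines V from its constant term
    in characteristic 0. *)
Lemma fps_binomial_pow m c :
  (fps_binomial m.+1%:R^-1 c : fps rat) ^+ m.+1 = 1 + fpsC c * @fpsX rat.
Proof.
set a := _^-1; pose u : fps rat := fps_binomial a c; pose V := u ^+ m.+1.
have u0 : u 0%N = 1 := fps_binomial0 _ _.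
have V0 : V 0%N = 1.
  rewrite /V; elim: m.+1 => // l IH; by rewrite exprS fpsM0 u0 IH mulr1.
have E : (1 + fpsC c * @fpsX rat) * fps_theta V = fpsC c * (@fpsX rat * V).
  rewrite fps_thetaXn mulrCA fps_binomial_theta -fpsC_nat.
  have -> : fpsC c = fpsC m.+1%:R * fpsC (a * c).
    by rewrite -fpsC_mul mulrA mulfV ?mul1r // pnatr_eq0.
  by rewrite /V exprS -/u; ring.
have rec d : d.+1%:R * V d.+1 = c * (1 - d%:R) * V d.
  have := congr1 (fun f : fps rat => f d.+1) E.
  rewrite /= mulrDl mul1r -mulrA fpsD !fpsCM !fpsXMS /fps_theta => {}E.
  by rewrite mulrBr mulrBl mulr1 -E; ring.
have VS d : V d.+1 = c * (1 - d%:R) * V d / d.+1%:R.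
  by rewrite -rec mulrC mulKf // pnatr_eq0.
rewrite -/u -/V; apply: fpsP => d; rewrite fpsD fpsCM fps1 /fpsX.
elim: d => [|[|d] IH]; first by rewrite V0 mulr0 addr0.
  by rewrite VS V0 /=; field.
rewrite VS IH; case: d {IH} => [|d] /=; last by rewrite !(mulr0n, mulr0, addr0, mul0r).
by rewrite subrr !(mulr0n, mulr0, addr0, mul0r).
Qed.

(** The series h with 1 + 2^(m+1) h = ((1 + t) / (1 - t))^(2^m). It is defined by
    a recursion that amounts to squaring this equation, because the recursion
    shows that the coefficients are integers. *)
Fixpoint pfister_series m : fps int :=
  if m is m'.+1 then pfister_series m' + 2%:R ^+ m' * pfister_series m' ^+ 2
  else fun d => (0 < d)%:R.

Lemma pfister_series00 m : pfister_series m 0%N = 0.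
Proof.
elim: m => [|m IH] //=; rewrite fpsD expr2 !fpsM0 IH; ring.
Qed.

Lemma pfister_series01 m : pfister_series m 1%N = 1.
Proof.
elim: m => [|m IH] //=.
rewrite fpsD IH expr2 mulrCA fpsMS pfister_series00 mul0r add0r.
by rewrite !fpsM0 pfister_series00 !mulr0 addr0.
Qed.

Lemma pfister_series0 :
  (1 - @fpsX int) * pfister_series 0 = @fpsX int.
Proof.
apply: fpsP => d; rewrite mulrBl mul1r fpsD fpsN.
by case: d => [|[|d]]; rewrite ?fpsXM0 ?fpsXMS.
Qed.

Lemma pfister_seriesS m : 1 + 2%:R ^+ m.+2 * pfister_series m.+1 =
  (1 + 2%:R ^+ m.+1 * pfister_series m) ^+ 2.
Proof. by rewrite /= !exprS; ring. Qed.

Lemma pfister_seriesE m : 1 + 2%:R ^+ m.+1 * pfister_series m =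
  (1 + 2%:R * pfister_series 0) ^+ (2 ^ m).
Proof.
elim: m => [|m IH]; first by rewrite expr1.
by rewrite pfister_seriesS IH -exprM expnSr.
Qed.

Lemma fps_int_half (f : fps int) : 2%:R * f = 0 -> f = 0.
Proof.
move=> E; apply: fpsP => d; have := congr1 (fun g : fps int => g d) E.
by rewrite -fpsC_nat fpsCM => /eqP; rewrite mulf_eq0 => /= /eqP.
Qed.

Definition pfister_series_odd m : fps int :=
  fun d => (odd d)%:R * pfister_series m d.

(** Replacing t by -t inverts (1 + t) / (1 - t), hence also w = 1 + 2^(m+1) h.
    As h(-t) w = - h only involves integral series, it is proved by induction
    on m rather than by dividing by 2^(m+1). *)
Lemma pfister_seriesN m : twist (-1) (pfister_series m) *
  (1 + 2%:R ^+ m.+1 * pfister_series m) = - pfister_series m.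
Proof.
elim: m => [|m IH].
  rewrite expr1; have E := pfister_series0; set h := pfister_series 0 in E *.
  have F := congr1 (twist (-1)) E.
  rewrite twistM twistD twistN twist1 twistX fpsCN fpsC1 in F.
  apply: (@fps_mulI _ (1 - @fpsX int)); first by [].
  transitivity (twist (-1) h * (1 - @fpsX int + 2%:R * ((1 - @fpsX int) * h))).
    by ring.
  rewrite E mulrN E -[RHS]mulN1r -F; ring.
rewrite pfister_seriesS /= twistD twistM expr2 !twistM.
have -> : twist (-1) (2%:R ^+ m) = 2%:R ^+ m :> fps int.
  by rewrite -natrX -fpsC_nat twistC.
set h := pfister_series m in IH *; set H := twist _ h in IH *.
set w := 1 + _ in IH *.
transitivity ((H * w) * w + 2%:R ^+ m * (H * w) ^+ 2); first by ring.
by rewrite IH /w exprS; ring.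
Qed.

(** Twice the odd part of h is h(t) - h(-t), which [pfister_seriesN] computes; the
    factor 2 can be cancelled over the integers. *)
Lemma pfister_series_oddE m :
  pfister_series_odd m * (1 + 2%:R ^+ m.+1 * pfister_series m) =
  pfister_series m.+1.
Proof.
apply/eqP; rewrite -subr_eq0; apply/eqP/fps_int_half.
have -> : forall x y : fps int, 2%:R * (x - y) = 2%:R * x - 2%:R * y.
  by move=> x y; ring.
have -> : 2%:R * (pfister_series_odd m *
   (1 + 2%:R ^+ m.+1 * pfister_series m)) =
  (pfister_series m - twist (-1) (pfister_series m)) *
   (1 + 2%:R ^+ m.+1 * pfister_series m).
  rewrite mulrA; congr (_ * _); apply: fpsP => d.
  rewrite -fpsC_nat fpsCM fpsD fpsN /twist /pfister_series_odd -signr_odd.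
  by case: (odd d) => /=; ring.
by rewrite mulrBl pfister_seriesN /= exprS; ring.
Qed.

Section PiSeries.
Variable m : nat.
Let p : fps rat := pi_series m.+1.
Let u : fps rat := fps_binomial (2 ^+ m)^-1 (2 ^+ m.+1).

Lemma pi_seriesE : p * (1 + u) = 1 + u - 2%:R.
Proof.
pose v : fps rat := fps_inv 2^-1 ((1 + u) : fps rat).
have vE : (1 + u) * v = 1.
  by apply: fps_inv_mul; rewrite fpsD /u fps_binomial0.
have -> : p = 1 - 2%:R * v.
  by apply: fpsP => d; rewrite fpsD fpsN -fpsC_nat fpsCM.
transitivity (1 + u - 2%:R * ((1 + u) * v)); first by ring.
by rewrite vE mulr1.
Qed.

Lemma pi_series0 : p 0%N = 0.
Proof. by rewrite /p /pi_series /= /fps_inv /= /fps_one eqxx mulr1n mulfV ?subrr. Qed.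

Lemma rat_fps_mulIn (c : nat) (f g : fps rat) : (0 < c)%N -> c%:R * f = c%:R * g -> f = g.
Proof.
move=> c0 E; apply: fpsP => d; have := congr1 (fun g : fps rat => g d) E.
by rewrite -fpsC_nat !fpsCM; apply: mulfI; rewrite pnatr_eq0 -lt0n.
Qed.

(** If u = (1 + 2^(m+1) t)^(1 / 2^m), then p = (u - 1) / (u + 1), so that
    (1 + p) / (1 - p) = u and 1 + 2^(m+1) h(p) = u^(2^m) = 1 + 2^(m+1) t. *)
Lemma subst_pfister_pi :
  fps_subst (fps_map intr (pfister_series m)) p = @fpsX rat.
Proof.
have p0 := pi_series0; pose h0 := fps_map (intr : int -> rat) (pfister_series 0).
pose G := 1 + 2%:R * h0.
have subst_nat c : fps_subst (c%:R : fps rat) p = c%:R by rewrite -fpsC_nat fps_substC.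
have Gu : fps_subst G p = u.
  have hE : fps_subst h0 p - p * fps_subst h0 p = p.
    have := congr1 (fun f => fps_subst (fps_map intr f) p) pfister_series0.
    rewrite fps_mapM fps_mapD fps_map1 fps_mapN fps_mapX fps_substM //.
    rewrite fps_substD fps_subst1 fps_substN fps_substX ?pi_series0 // => E.
    by move: E; rewrite /= mulrBl mul1r.
  rewrite /G fps_substD fps_subst1 fps_substM // subst_nat; set H := fps_subst h0 p in hE *.
  apply: (@rat_fps_mulIn 2) => //; rewrite -/u.
  have kE : (1 + u) * (1 - p) = 2%:R.
    by rewrite mulrBr mulr1 [_ * p]mulrC pi_seriesE subKr.
  rewrite -{1}kE.
  transitivity ((1 + u) * (1 - p + 2%:R * (H - p * H))); first by ring.
  rewrite hE; transitivity (1 + u + p * (1 + u)); first by ring.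
  by rewrite pi_seriesE; move: (u : fps rat) => v; ring.
have main : fps_subst (fps_map intr (1 + 2%:R ^+ m.+1 * pfister_series m)) p =
   1 + fpsC (2 ^+ m.+1) * @fpsX rat.
  rewrite pfister_seriesE fps_mapXn fps_substXn // fps_mapD fps_map1 fps_mapM fps_map_nat.
  rewrite -/h0 -/G Gu /u -natrX.
  have : (0 < 2 ^ m)%N by rewrite expn_gt0.
  by case: (2 ^ m)%N => // l _; rewrite fps_binomial_pow.
move: main; rewrite fps_mapD fps_map1 fps_substD fps_subst1 => /addrI.
rewrite -natrX fps_mapM fps_map_nat fps_substM // subst_nat -natrX fpsC_nat.
by apply: rat_fps_mulIn; rewrite expn_gt0.
Qed.

(** Since h has integer coefficients and starts with t, the coefficient of t^d
    in h(p) = t expresses p_d as an integral polynomial in p_1, ..., p_(d-1). *)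
Lemma pi_series_int d : p d \is a Num.int.
Proof.
pose h := pfister_series m.
elim/ltn_ind: d => d IH.
case: d IH => [|d] IH; first by rewrite pi_series0.
have powint l e : (e <= d)%N -> (p ^+ l) e \is a Num.int.
  elim: l e => [|l IHl] e ed; first by rewrite expr0 fps1 rpred_nat.
  rewrite exprS fpsM; apply: rpred_sum => i _; apply: rpredM.
    by apply: IH; rewrite ltnS (leq_trans (leq_ord i)).
  by apply: IHl; rewrite (leq_trans (leq_subr _ _)).
have powint' l : (p ^+ l.+2) d.+1 \is a Num.int.
  rewrite exprS fpsM; apply: rpred_sum => -[[|i] i_d] _ /=.
    by rewrite pi_series0 mul0r; exact: int_num0.
  case: (ltnP i d) => i_d'; last first.
    have -> : i = d by apply/eqP; rewrite eqn_leq i_d' andbT; apply: i_d.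
    by rewrite subnn fps_expr_lt ?mulr0 ?pi_series0 //; exact: int_num0.
  by apply: rpredM; [apply: IH | apply: powint; rewrite subSS leq_subr].
have := congr1 (fun f : fps rat => f d.+1) subst_pfister_pi.
rewrite /= (@fps_substE _ _ _ _ d.+2) ?pi_series0 // !big_ord_recl /=.
rewrite pfister_series00 pfister_series01 mul0r add0r mul1r expr1.
move/(canRL (addrK _)) => ->; apply: rpredB; first by rewrite /fpsX rpred_nat.
by apply: rpred_sum => i _; rewrite rpredM // ?intr_int.
Qed.

Lemma pi_coefE : fps_map (intr : int -> rat) (pi_coef m.+1) = p.
Proof.
by apply: fpsP => d; rewrite /fps_map /pi_coef; apply/numqK/pi_series_int.
Qed.

Lemma pi_coef0 : pi_coef m.+1 0%N = 0.
Proof. by rewrite /pi_coef [pi_series _ _]pi_series0. Qed.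

Lemma subst_pfister_pi_int : fps_subst (pfister_series m) (pi_coef m.+1) = @fpsX int.
Proof.
have := subst_pfister_pi; rewrite -pi_coefE -fps_map_subst -(fps_mapX intr) => E.
apply: fpsP => d; have := congr1 (fun f : fps rat => f d) E.
exact: intr_inj.
Qed.

End PiSeries.

(** * Exterior powers of an orthogonal sum with a line *)

Lemma inj_surj_bij (T U : finType) (g : T -> U) :
  injective g -> (forall u, exists t, u == g t) -> bijective g.
Proof.
move=> gI gS; exists (fun u => xchoose (gS u)) => [t|u].
  by apply: gI; apply/esym/eqP/(xchooseP (gS (g t))).
exact/esym/eqP/(xchooseP (gS u)).
Qed.

Section IncrSplit.
Variable n : nat.

Lemma map_val_rshift1 (s : seq 'I_n) :
  map val (map (@rshift 1 n) s) = map succn (map val s).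
Proof. by rewrite -!map_comp. Qed.

Fact incr_lift_subproof d (S : incr d n) :
  sorted ltn (map val [tuple of map (@rshift 1 n) (val S)]).
Proof.
by case: S => S /= sS; rewrite map_val_rshift1 sorted_map.
Qed.
Definition incr_lift d (S : incr d n) : incr d (1 + n) :=
  Sub [tuple of map (@rshift 1 n) (val S)] (incr_lift_subproof S).

Fact incr_cons_subproof d (S : incr d n) :
  sorted ltn (map val [tuple of lshift n ord0 :: map (@rshift 1 n) (val S)]).
Proof.
rewrite /= (path_sortedE ltn_trans) incr_lift_subproof andbT.
by apply/allP => i; rewrite -map_comp => /mapP[j _ ->].
Qed.
Definition incr_cons d (S : incr d n) : incr d.+1 (1 + n) :=
  Sub [tuple of lshift n ord0 :: map (@rshift 1 n) (val S)] (incr_cons_subproof S).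

Lemma rshift_seq (s : seq 'I_(1 + n)) :
  all (fun i => 0 < val i)%N s -> exists s', s = map (@rshift 1 n) s'.
Proof.
elim: s => [|x s IH] /=; first by exists [::].
case/andP=> x0 /IH[s' ->]; have [i|i] := splitP x.
  by move=> xi; move: x0; rewrite /= xi ord1.
move=> xi; exists (i :: s'); congr (_ :: _).
by apply: val_inj.
Qed.

Lemma incr_liftP d (s : d.-tuple 'I_(1 + n)) : sorted ltn (map val s) ->
  all (fun i => 0 < val i)%N s ->
  exists S : incr d n, val s = map (@rshift 1 n) (val S).
Proof.
move=> ss /rshift_seq[s' E].
have sz : size s' == d by rewrite -(size_map (@rshift 1 n)) -E size_tuple.
have srt : sorted ltn (map val (Tuple sz)).
  by move: ss; rewrite E map_val_rshift1 sorted_map.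
by exists (Sub (Tuple sz) srt).
Qed.

(** A strictly increasing sequence in {0, ..., n} either avoids 0 or starts with
    it. The factor 'I_1, the basis of a line, makes this an indexing of
    a basis of a sum of the form q' + <a> q''. *)
Definition incr_split d (x : incr d.+1 n + 'I_1 * incr d n) : incr d.+1 (1 + n) :=
  match x with inl U => incr_lift U | inr p => incr_cons p.2 end.

Lemma incr_split_bij d : bijective (@incr_split d).
Proof.
apply: inj_surj_bij => [|U].
  have rI : injective (map (@rshift 1 n)) := inj_map (@rshift_inj 1 n).
  have diff (S : incr d.+1 n) (T : incr d n) : incr_lift S <> incr_cons T.
    move/(congr1 (fun U => val (tnth (val U) ord0))).
    by rewrite /= tnth_map.
  case=> [S|[i S]] [T|[j T]] /=.
  - by move/(congr1 (fun U => val (val U))) => /= /rI E; congr inl; apply/val_inj/val_inj.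
  - by move/diff.
  - by move/esym/diff.
  - move/(congr1 (fun U => val (val U))) => /= -[/rI E].
    by rewrite [i]ord1 [j]ord1; congr (inr (_, _)); apply/val_inj/val_inj.
case: U => t srt; case/tupleP: t srt => x s srt.
have [x0|xpos] := posnP (val x).
  have [||S E] := @incr_liftP d s.
  - exact: path_sorted srt.
  - move: srt; rewrite /= (path_sortedE ltn_trans) x0 => /andP[+ _].
    by rewrite all_map.
  exists (inr (ord0, S)); apply/eqP/val_inj/val_inj => /=.
  by rewrite E; congr (_ :: _); apply: val_inj.
have [|S E] := @incr_liftP d.+1 [tuple of x :: s] srt.
  rewrite /= xpos; move: srt; rewrite /= (path_sortedE ltn_trans) => /andP[+ _].
  by rewrite all_map; apply: sub_all => i /=; apply: ltn_trans.
by exists (inl S); apply/eqP/val_inj/val_inj.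
Qed.

End IncrSplit.

Section ExteriorSum.
Variable K : fieldType.
Implicit Type q : qform K.

Lemma rep_ext d q : rep (ext d q) (fun S T : incr d (qdim q) =>
  \det (mxsub (tnth (val S)) (tnth (val T)) (gram q))).
Proof.
exists (@enum_val _ predT); first exact: enum_val_bij.
by move=> i j; rewrite mxE.
Qed.

(** The recursion lambda^(d+1)(<a> + q) = lambda^(d+1)(q) + <a> lambda^d(q). Sort
    the basis of the exterior power by whether the vector of <a> occurs: a minor
    with this vector among its rows only, or among its columns only, has a zero
    row or column, and one with the vector on both sides is a times a minor
    of q. *)
Lemma ext_orth_diag1 d (a : Kstar K) q :
  isometric (orth (ext d.+1 q) (tens (diag1 a) (ext d q)))
            (ext d.+1 (orth (diag1 a) q)).
Proof.
apply: (rep_isom (g := @incr_split (qdim q) d)).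
- exact: rep_orth (rep_ext _ _) (rep_tens (rep_self _) (rep_ext _ _)).
- exact: rep_ext.
- exact: incr_split_bij.
case=> [S|[i S]] [T|[j T]] /=.
- by congr (\det _); apply/matrixP => i j; rewrite mxE [RHS]mxE !tnth_map block_mxEdr.
- apply/esym; rewrite (expand_det_col _ ord0) big1 // => k _.
  by rewrite mxE tnth_map block_mxEdl mxE mul0r.
- apply/esym; rewrite (expand_det_row _ ord0) big1 // => k _.
  by rewrite mxE tnth_map block_mxEur mxE mul0r.
rewrite (expand_det_row _ ord0) big_ord_recl big1 => [|k _].
  rewrite addr0 /prodb /= [i]ord1 [j]ord1; congr (_ * _).
    by rewrite [RHS]mxE !tnth0 block_mxEul.
  rewrite /cofactor expr0 mul1r; congr (\det _); apply/matrixP => k l.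
  by rewrite [LHS]mxE [RHS]mxE [RHS]mxE [RHS]mxE !tnthS !tnth_map block_mxEdr.
by rewrite mxE tnthS tnth_map block_mxEur mxE mul0r.
Qed.
End ExteriorSum.

Section ExtTriv.
Variable K : fieldType.
Implicit Type q : qform K.

Lemma ext_deg0 q : isometric (ext 0 q) (diag1 (Kone K)).
Proof.
apply: (rep_isom (g := fun _ : incr 0 (qdim q) => 0 : 'I_1)).
- exact: rep_ext.
- exact: rep_self.
- apply: inj_surj_bij => [S T _|i].
    apply/val_inj/val_inj => /=.
    by rewrite (size0nil (size_tuple (val S))) (size0nil (size_tuple (val T))).
  have srt : sorted ltn (map val [tuple of [::] : seq 'I_(qdim q)]) by [].
  by exists (Sub [tuple] srt); rewrite [i]ord1.
by move=> S T; rewrite /= det_mx00 mxE eqxx.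
Qed.

Lemma ext_qzero d : isometric (ext d.+1 (qzero K)) (qzero K).
Proof.
have noI (i : 'I_0) : False by case: i.
have noS (S : incr d.+1 0) : False := noI (tnth (val S) ord0).
apply: (rep_isom (g := fun S : incr d.+1 0 => False_rect 'I_0 (noS S))).
- exact: rep_ext.
- exact: rep_self.
- by exists (fun i => False_rect _ (noI i)) => [S|i]; [case: (noS S) | case: (noI i)].
by move=> S; case: (noS S).
Qed.
End ExtTriv.

(** * Diagonalisation *)

Section Diagonalisation.
Variable K : fieldType.
Hypothesis two_neq0 : (2%:R : K) != 0.
Implicit Type q : qform K.

Lemma change_basis n (G P : 'M[K]_n) (sG : G^T = G) (uG : G \in unitmx) :
  P \in unitmx -> exists sG' uG',
  isometric (QForm sG uG) (@QForm K n (P *m G *m P^T) sG' uG').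
Proof.
move=> uP.
have sG' : (P *m G *m P^T)^T = P *m G *m P^T by rewrite !trmx_mul trmxK sG mulmxA.
have uG' : P *m G *m P^T \in unitmx by rewrite !unitmx_mul unitmx_tr uP uG.
exists sG', uG'; exists (invmx P), P => /=.
split; rewrite ?mulVmx ?mulmxV //.
by rewrite !mulmxA mulVmx // mul1mx -mulmxA -trmx_mul mulVmx // trmx1 mulmx1.
Qed.

(** The orthogonal complement of the first basis vector has the Schur complement
    of G 0 0 as Gram matrix. *)
Lemma split_block n (G : 'M[K]_(1 + n)) (sG : G^T = G) (uG : G \in unitmx) :
  G 0 0 != 0 -> exists (a : Kstar K) q, qdim q = n /\
    isometric (QForm sG uG) (orth (diag1 a) q).
Proof.
move=> a0; pose a : Kstar K := exist _ (G 0 0) a0.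
pose b : 'rV_n := ursubmx G; pose D : 'M_n := drsubmx G.
have GE : G = block_mx (val a)%:M b b^T D.
  rewrite -[G in LHS]submxK; congr block_mx.
    apply/matrixP => i j; rewrite !ord1 !mxE eqxx mulr1n /=.
    by congr (G _ _); apply: val_inj.
  by rewrite trmx_ursub sG.
pose P : 'M_(1 + n) := block_mx 1%:M 0 (- (val a)^-1 *: b^T) 1%:M.
pose S := D - (val a)^-1 *: (b^T *m b).
have uP : P \in unitmx by rewrite unitmxE det_lblock !det1 mulr1 unitr1.
have PGP : P *m G *m P^T = block_mx (val a)%:M 0 0 S.
  rewrite GE /P tr_block_mx !trmx1 trmx0 !mulmx_block.
  rewrite !(mul1mx, mulmx1, mul0mx, mulmx0, addr0, add0r) linearZ /= trmxK.
  rewrite mul_mx_scalar mul_scalar_mx !scalerA mulrN mulfV //= !scaleN1r addNr.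
  by rewrite !addNr mul0mx add0r -scalemxAl scaleNr addrC.
have [sG' [uG' iso]] := change_basis sG uG uP.
have sS : S^T = S.
  by move: (sG'); rewrite PGP tr_block_mx => /eq_block_mx[].
have uS : S \in unitmx.
  by move: (uG'); rewrite PGP block_diag_mx_unit => /andP[].
exists a, (QForm sS uS); split=> //; apply: isometric_trans iso _.
exists 1%:M, 1%:M; split; rewrite ?mulmx1 ?mul1mx ?trmx1 ?mulmx1 //.
Qed.

Lemma split_diag_entry n (G : 'M[K]_n.+1) (sG : G^T = G) (uG : G \in unitmx) i :
  G i i != 0 -> exists (a : Kstar K) q, qdim q = n /\
    isometric (QForm sG uG) (orth (diag1 a) q).
Proof.
move=> Gii; have uP : (tperm_mx 0 i : 'M[K]_n.+1) \in unitmx := unitmx_perm _ _.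
have [sG' [uG' iso]] := change_basis sG uG uP.
have [|a [q [qn iso']]] := @split_block n _ sG' uG'.
  by rewrite tr_tperm_mx -xrowE -xcolE !mxE tpermL.
by exists a, q; split=> //; apply: isometric_trans iso iso'.
Qed.

Lemma delta_mulmx m n p (i : 'I_m) (j : 'I_n) (A : 'M[K]_(n, p)) k :
  (delta_mx i j *m A) i k = A j k.
Proof.
rewrite mxE (bigD1 j) //= mxE !eqxx mul1r big1 ?addr0 // => l /negPf lj.
by rewrite mxE eqxx lj mul0r.
Qed.

Lemma split_qform q n : qdim q = n.+1 -> exists (a : Kstar K) q', qdim q' = n /\
  isometric q (orth (diag1 a) q').
Proof.
case: q => m G sG uG /= mn; subst m.
have [/existsP[i Gii]|/existsPn Gd0] := boolP [exists i, G i i != 0].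
  exact: split_diag_entry Gii.
have [j Gj] : exists j, G 0 j != 0.
  have [/existsP[j Gj]|/existsPn G0] := boolP [exists j, G 0 j != 0].
    by exists j.
  move: uG; rewrite unitmxE (expand_det_row _ 0) big1 ?unitr0 // => j _.
  by have /negPn/eqP-> := G0 j; rewrite mul0r.
have j0 : j != 0 by apply: contraNneq (Gd0 0) => j0; rewrite -{2}j0.
(* The vector e_0 + e_j is anisotropic: its value is 2 G 0 j. *)
pose P : 'M[K]_n.+1 := 1%:M + delta_mx 0 j.
have uP : P \in unitmx.
  suff: P *m (1%:M - delta_mx 0 j) = 1%:M by move/mulmx1_unit => [].
  rewrite mulmxBr mulmx1 mulmxDl mul1mx mul_delta_mx_0 // addr0.
  by rewrite addrK.
have [sG' [uG' iso]] := change_basis sG uG uP.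
have [|a [q [qn iso']]] := @split_diag_entry n _ sG' uG' 0.
  have sGE i k : G k i = G i k by rewrite -[in RHS]sG mxE.
  have Gii i : G i i = 0 by have /negPn/eqP := Gd0 i.
  have GP i : (G *m P^T) i 0 = G i 0 + G i j.
    rewrite -[G *m _]trmxK trmx_mul trmxK sG mxE mulmxDl mul1mx mxE delta_mulmx.
    by rewrite !(sGE i).
  rewrite -mulmxA mulmxDl mul1mx mxE delta_mulmx !GP !Gii sGE add0r addr0.
  by rewrite -mulr2n -mulr_natl mulf_neq0 // sGE.
by exists a, q; split=> //; apply: isometric_trans iso iso'.
Qed.

(** Diagonalisation as an induction principle on isometry classes. *)
Lemma iso_ind (P : isoclass K -> Prop) : P 0 ->
  (forall a x, P x -> P (cls (diag1 a) + x)) -> forall x, P x.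
Proof.
move=> P0 PD x; rewrite -[x]cls_repr; move: (repr x) => {x} q.
have [n] : exists n, qdim q = n by exists (qdim q).
elim: n q => [|n IH] q qn.
  suff -> : cls q = 0 by [].
  apply/clsP; case: q qn => m G sG uG /= m0; subst m.
  exists 1%:M, 1%:M; split; rewrite ?mulmx1 ?mul1mx //.
  by apply/matrixP => -[].
have [a [q' [q'n /clsP ->]]] := split_qform qn.
by rewrite -clsD; apply/PD/IH.
Qed.

End Diagonalisation.

(** * The Grothendieck-Witt ring and its lambda operations *)

Section LambdaOperations.
Variable K : fieldType.
Hypothesis two_neq0 : (2%:R : K) != 0.
Implicit Types (a b : Kstar K) (x y : GW K) (p q : isoclass K).
Notation inj := (@ginj (isoclass K)).

Lemma ginjD p q : inj (p + q) = inj p + inj q.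
Proof.
apply: esym; rewrite -[LHS]/(gadd (ginj p) (ginj q)) gaddE /=.
by rewrite /ginj add0r.
Qed.

Lemma ginjM p q : inj (p * q) = inj p * inj q.
Proof.
apply: esym; rewrite -[LHS]/(gmul (ginj p) (ginj q)) gmulE /=.
by rewrite /ginj !mulr0 mul0r !addr0.
Qed.

Lemma ginj0 : inj 0 = 0. Proof. by []. Qed.
Lemma ginj1 : inj 1 = 1. Proof. by []. Qed.

Lemma GW_sub x : exists p q, x = inj p - inj q.
Proof. by exists (repr x).1, (repr x).2; rewrite -gcls_sub gcls_repr. Qed.

Fact Kmul_neq0 a b : val a * val b != 0.
Proof. by rewrite mulf_neq0 ?(valP a) ?(valP b). Qed.
Definition Kmul a b : Kstar K := Sub (val a * val b) (Kmul_neq0 a b).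
Fact Kopp_neq0 a : - val a != 0.
Proof. by rewrite oppr_eq0 (valP a). Qed.
Definition Kopp a : Kstar K := Sub (- val a) (Kopp_neq0 a).

Lemma cls_diagM a b : cls (diag1 a) * cls (diag1 b) = cls (diag1 (Kmul a b)).
Proof.
rewrite clsM; apply/clsP.
apply: (rep_isom (g := fun _ : 'I_1 * 'I_1 => 0 : 'I_1)).
- exact: rep_tens (rep_self _) (rep_self _).
- exact: rep_self.
- exists (fun _ => (0, 0)) => [[i j]|i]; first by rewrite [i]ord1 [j]ord1.
  by rewrite [i]ord1.
by case=> i j [i' j']; rewrite /prodb /= !ord1 !mxE !eqxx !mulr1n.
Qed.

Lemma diag_classM a b : diag_class a * diag_class b = diag_class (Kmul a b).
Proof. by rewrite /diag_class -cls_diagM ginjM. Qed.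

Lemma diag_class1 : diag_class (Kone K) = 1. Proof. by []. Qed.

Lemma diag_class_sq a : diag_class a * diag_class a = 1.
Proof.
rewrite diag_classM -diag_class1; congr ginj; apply/clsP.
exists (val a)%:M, (val a)^-1%:M; split.
- by rewrite -scalar_mxM mulfV ?(valP a).
- by rewrite -scalar_mxM mulVf ?(valP a).
- by rewrite /= tr_scalar_mx -!scalar_mxM mulr1.
Qed.

Lemma cls_hyperbolic a :
  isometric (orth (diag1 a) (diag1 (Kopp a))) (orth (diag1 (Kone K)) (diag1 (Kopp1 K))).
Proof.
have a0 := valP a; set c := val a in a0 *.
(* The identity c = u^2 - v^2 shows that <1, -1> represents c. *)
pose u := (c + 1) / 2%:R; pose v := (c - 1) / 2%:R.
exists (block_mx u%:M v%:M v%:M u%:M),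
  (block_mx (u / c)%:M (- v / c)%:M (- v / c)%:M (u / c)%:M).
rewrite /= (@scalar_mx_block _ 1 1) tr_block_mx !tr_scalar_mx !mulmx_block.
rewrite !(mulmx0, mul0mx, addr0, add0r) -!scalar_mxM -!raddfD /=.
have E0 : (0 : 'M[K]_1) = 0%:M by rewrite raddf0.
rewrite E0; split; congr block_mx; congr (_%:M); rewrite /u /v /= -/c.
all: by [field | field; rewrite ?a0 ?two_neq0].
Qed.

Lemma hyperbolic a : diag_class a + diag_class (Kopp a) = 1 + diag_class (Kopp1 K).
Proof.
rewrite -diag_class1 /diag_class -!ginjD !clsD; congr ginj.
exact/clsP/cls_hyperbolic.
Qed.

(** This is <<a, a>> = <<a, -1>>, the origin of the factor {-1}^n of the product
    formula. It reduces to the fact that <a, -a> is a hyperbolic plane. *)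
Lemma pfister1_sq a : pfister1 a * pfister1 a = pfister1 a * pfister1 (Kopp1 K).
Proof.
rewrite /pfister1 diag_class1; set u := diag_class a.
have aN : u * diag_class (Kopp1 K) = diag_class (Kopp a).
  rewrite diag_classM; congr diag_class; apply: val_inj; exact: mulrN1.
transitivity (1 - u - u + u * u); first by ring.
rewrite diag_class_sq; have := hyperbolic a; rewrite -aN -/u.
set e := diag_class _ => E; transitivity (1 - u - u + (1 + e) - e); first by ring.
by rewrite -E; ring.
Qed.

Lemma pfister1_double a : pfister1 a * pfister1 a = 2%:R * pfister1 a.
Proof.
rewrite /pfister1 diag_class1; set u := diag_class a.
transitivity (1 - u - u + u * u); first by ring.
by rewrite diag_class_sq; ring.
Qed.

Notation L p := (lambda_iso p : fps (GW K)).
Notation C := (@fpsC (GW K)).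
Notation X := (@fpsX (GW K)).

Lemma lambda_iso_coef0 p : L p 0%N = 1.
Proof.
rewrite /lambda_iso -[p]cls_repr iso_extE -ginj1; congr ginj.
exact/clsP/ext_deg0.
Qed.

Lemma lambda_iso0 : L 0 = 1.
Proof.
apply: fpsP => -[|d]; first exact: lambda_iso_coef0.
rewrite /lambda_iso iso_extE -[RHS]ginj0; congr ginj.
exact/clsP/ext_qzero.
Qed.

Lemma lambda_iso_diag a p :
  L (cls (diag1 a) + p) = (1 + C (diag_class a) * X) * L p.
Proof.
apply: fpsP => d; rewrite mulrDl mul1r -mulrA fpsD fpsCM.
case: d => [|d]; first by rewrite fpsXM0 mulr0 addr0 !lambda_iso_coef0.
rewrite fpsXMS -[p]cls_repr clsD /lambda_iso !iso_extE /diag_class.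
rewrite -ginjM -ginjD clsM clsD; congr ginj.
exact/clsP/isometric_sym/ext_orth_diag1.
Qed.

Lemma lambda_isoD p q : L (p + q) = L p * L q.
Proof.
elim/(iso_ind two_neq0): p => [|a p IH]; first by rewrite add0r lambda_iso0 mul1r.
by rewrite -addrA !lambda_iso_diag IH mulrA.
Qed.

(** [lambda] is computed on one representation of its argument as a difference;
    this determines it from any other, the series of a form being
    cancellable. *)
Lemma lambda_sub p q : (lambda (inj p - inj q) : fps (GW K)) * L q = L p.
Proof.
set x := inj p - inj q; pose p' := (repr x).1; pose q' := (repr x).2.
have [c E] : Defs.geq (p', q') (p, q).
  by apply/gclsP; rewrite [RHS]gcls_sub /p' /q' -surjective_pairing gcls_repr.
have F : (lambda x : fps (GW K)) * L q' = L p'.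
  pose V : fps (GW K) := fps_inv 1 (L q').
  have LV : L q' * V = 1 by apply: fps_inv_mul; rewrite lambda_iso_coef0 mulr1.
  have -> : (lambda x : fps (GW K)) = L p' * V by [].
  by rewrite -mulrA [V * _]mulrC LV mulr1.
apply: (@fps_mulI _ (L (q' + c))); first exact: lambda_iso_coef0.
transitivity ((lambda x : fps (GW K)) * L q' * (L q * L c)).
  by rewrite lambda_isoD; ring.
by rewrite F -!lambda_isoD addrA E /= -addrA [p + _]addrC.
Qed.

Lemma lambda_coef0 x : lambda x 0%N = 1.
Proof.
have [p [q ->]] := GW_sub x.
have := congr1 (fun f : fps (GW K) => f 0%N) (lambda_sub p q).
by rewrite /= fpsM0 !lambda_iso_coef0 mulr1.
Qed.

Lemma lambdaD x y :
  lambda (x + y) = (lambda x : fps (GW K)) * lambda y :> fps (GW K).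
Proof.
have [p [q ->]] := GW_sub x; have [p' [q' ->]] := GW_sub y.
have -> : inj p - inj q + (inj p' - inj q') = inj (p + p') - inj (q + q').
  by rewrite !ginjD; ring.
apply: (@fps_mulI _ (L (q + q'))); first exact: lambda_iso_coef0.
rewrite mulrC lambda_sub !lambda_isoD -(lambda_sub p q) -(lambda_sub p' q').
by ring.
Qed.

Lemma lambda_iso_scale a p : L (cls (diag1 a) * p) = twist (diag_class a) (L p).
Proof.
elim/(iso_ind two_neq0): p => [|b p IH].
  by rewrite mulr0 lambda_iso0 twist1.
rewrite mulrDr cls_diagM !lambda_iso_diag IH twistM twistD twist1 twistM.
by rewrite twistC twistX -diag_classM fpsC_mul; ring.
Qed.

(** That is, lambda^d(<a> x) = <a>^d lambda^d(x). *)
Lemma lambda_scale a x :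
  lambda (diag_class a * x) = twist (diag_class a) (lambda x) :> fps (GW K).
Proof.
have [p [q ->]] := GW_sub x.
rewrite mulrBr -!ginjM; apply: (@fps_mulI _ (L (cls (diag1 a) * q))).
  exact: lambda_iso_coef0.
by rewrite mulrC lambda_sub !lambda_iso_scale -twistM mulrC lambda_sub.
Qed.

Definition pfister_seq (s : seq (Kstar K)) : GW K := \prod_(b <- s) pfister1 b.

Lemma pfister_seqE n (a : n.-tuple (Kstar K)) : pfister a = pfister_seq a.
Proof. by rewrite /pfister_seq big_tuple. Qed.

Lemma pfister_seq_sq s : pfister_seq s * pfister_seq s = 2%:R ^+ size s * pfister_seq s.
Proof.
rewrite /pfister_seq; elim: s => [|b s IH]; first by rewrite big_nil.
rewrite big_cons mulrACA IH pfister1_double /= exprS; ring.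
Qed.

Notation imap := (fps_map (intr : int -> GW K)).

Lemma lambda_diag a : lambda (diag_class a) = 1 + C (diag_class a) * X :> fps (GW K).
Proof.
have := lambda_sub (cls (diag1 a)) 0.
rewrite ginj0 subr0 lambda_iso0 mulr1 -[cls _]addr0 lambda_iso_diag.
by rewrite lambda_iso0 mulr1 addr0.
Qed.

Lemma lambda_pfister1 a : lambda (pfister1 a) =
  1 + C (pfister1 a) * imap (pfister_series 0) :> fps (GW K).
Proof.
have hE := congr1 imap pfister_series0; move: hE.
rewrite fps_mapM fps_mapD fps_map1 fps_mapN fps_mapX.
set h := imap _ => hE.
apply: (@fps_mulI _ (lambda (diag_class a))); first exact: lambda_coef0.
rewrite -lambdaD /pfister1 addrC subrK diag_class1 -diag_class1 !lambda_diag diag_class1.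
rewrite fpsCD fpsCN fpsC1 mul1r; set u := C _.
have u2 : u * u = 1 by rewrite -fpsC_mul diag_class_sq fpsC1.
(* Multiplying by 1 - t turns h into t. *)
apply: (@fps_mulI _ (1 - X)); first by rewrite fpsD fpsN subr0.
transitivity ((1 + u * X) * ((1 - X) + (1 - u) * ((1 - X) * h))); last by ring.
rewrite hE; transitivity (1 - (u * u) * X ^+ 2); first by rewrite u2; ring.
by ring.
Qed.

(** If phi' = <<b>> phi = phi - <b> phi, then lambda_t(phi') is the quotient of
    lambda_t(phi) by lambda_(<b> t)(phi). Because <b>^2 = 1, replacing t by <b> t
    changes only the odd part of h, by the factor <b>; the recursion for h then
    matches in view of [pfister_series_oddE] and of the relations
    phi^2 = 2^n phi and <<b>>^2 = 2 <<b>>. *)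
Lemma lambda_pfister_seq b s : lambda (pfister_seq (b :: s)) =
  1 + C (pfister_seq (b :: s)) * imap (pfister_series (size s)) :> fps (GW K).
Proof.
elim: s b => [|b' s IH] b.
  by rewrite /pfister_seq big_seq1; apply: lambda_pfister1.
have phiE : pfister_seq [:: b, b' & s] =
    pfister_seq (b' :: s) - diag_class b * pfister_seq (b' :: s).
  by rewrite /pfister_seq big_cons {1}/pfister1 diag_class1 mulrBl mul1r.
set phi' := pfister_seq [:: b, b' & s] in phiE *.
have {}IH := IH b'; set phi := pfister_seq (b' :: s) in phiE IH.
set m := size s in IH.
apply: (@fps_mulI _ (lambda (diag_class b * phi))); first exact: lambda_coef0.
rewrite -lambdaD phiE addrC subrK lambda_scale IH twistD twist1 twistM twistC.
set H := imap (pfister_series m); set Ho := imap (pfister_series_odd m).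
set H' := imap (pfister_series _).
have -> : twist (diag_class b) H = H - C (1 - diag_class b) * Ho.
  apply: fpsP => d; rewrite fpsD fpsN fpsCM /twist.
  have -> : Ho d = (odd d)%:R * H d by rewrite /Ho /fps_map rmorphM rmorph_nat.
  have -> : diag_class b ^+ d = diag_class b ^+ odd d.
    rewrite -[in LHS](odd_double_half d) exprD -mul2n exprM expr2 diag_class_sq.
    by rewrite expr1n mulr1.
  by case: (odd d); rewrite /= ?expr1 ?expr0; ring.
have HH' : Ho * (1 + 2%:R ^+ m.+1 * H) = H'.
  rewrite -[H']/(imap (pfister_series m.+1)) -pfister_series_oddE.
  rewrite fps_mapM fps_mapD fps_map1 fps_mapM.
  by rewrite fps_mapXn fps_map_nat.
have HS : 1 + 2%:R ^+ m.+2 * H' = (1 + 2%:R ^+ m.+1 * H) ^+ 2.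
  have := congr1 imap (pfister_seriesS m).
  by rewrite fps_mapXn !fps_mapD !fps_map1 !fps_mapM !fps_mapXn !fps_map_nat.
have -> : phi - diag_class b * phi = (1 - diag_class b) * phi by ring.
rewrite fpsC_mul; set e := C (1 - _); set p := C phi.
have ee : e * e = 2%:R * e.
  by rewrite -fpsC_mul -[1 - _]/(pfister1 b) pfister1_double fpsC_mul fpsC_nat.
have pp : p * p = 2%:R ^+ m.+1 * p.
  by rewrite -fpsC_mul pfister_seq_sq fpsC_mul -!natrX fpsC_nat.
set c := 2%:R ^+ m.+1 in HH' HS pp.
have {}HS : 1 + 2%:R * c * H' = (1 + c * H) ^+ 2 by rewrite -HS exprS.
transitivity (1 + p * H + p * e * (H' - Ho) + (p * p) * e * H * H' -
              (p * p) * (e * e) * Ho * H');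
  last by ring.
rewrite ee pp.
transitivity (1 + p * H +
              p * e * (H' * (1 + c * H) - Ho * (1 + 2%:R * c * H')));
  last by ring.
by rewrite HS -HH'; ring.
Qed.

Lemma pi_op_substE n d x : pi_op n d x = fps_subst (lambda x) (imap (pi_coef n)) d.
Proof. by []. Qed.

Lemma imap_pi0 m : imap (pi_coef m.+1) 0%N = 0.
Proof. by rewrite /fps_map pi_coef0. Qed.

Lemma pi_op_deg0 n x : pi_op n 0 x = 1.
Proof. by rewrite /pi_op /fps_comp big_ord1 lambda_coef0 mul1r. Qed.

(** As pi_n is inverse to the series h of [lambda_pfister_seq], one has
    lambda_(pi_n(t))(phi) = 1 + phi t. *)
Lemma pi_opD_pfister n d x phi : (0 < n)%N -> Pf n phi ->
  pi_op n d.+1 (x + phi) = pi_op n d.+1 x + phi * pi_op n d x.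
Proof.
case: n => // m _ [a ->]; rewrite pfister_seqE !pi_op_substE.
case/tupleP: a => b a; rewrite lambdaD fps_substM ?imap_pi0 // lambda_pfister_seq.
rewrite size_tuple fps_substD fps_subst1 fps_substM ?imap_pi0 // fps_substC -fps_map_subst.
rewrite subst_pfister_pi_int fps_mapX mulrDr mulr1 fpsD; congr (_ + _).
by rewrite mulrCA fpsCM [_ * X]mulrC fpsXMS.
Qed.

Lemma pi_op_zero n d : pi_op n d (0 : GW K) = (d == 0%N)%:R.
Proof.
rewrite pi_op_substE.
have -> : lambda (0 : GW K) = 1 :> fps (GW K); last by rewrite fps_subst1.
by have := lambda_sub 0 0; rewrite subrr lambda_iso0 mulr1.
Qed.

End LambdaOperations.

(** * Multinomial coefficients and the product formula for sequences *)

Section Multinomial.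
Local Open Scope nat_scope.

(** The number of pairs of subsets, of s and t elements, that cover a set of d
    elements. The three terms of the recursion put the last element in the first
    subset only, in the second only, or in both. *)
Fixpoint cover_count d s t : nat :=
  if d is d'.+1 then
    (if s is s'.+1 then cover_count d' s' t else 0) +
    (if t is t'.+1 then cover_count d' s t' else 0) +
    (if s is s'.+1 then if t is t'.+1 then cover_count d' s' t' else 0 else 0)
  else (s == 0) && (t == 0).

Lemma cover_count_lt_l d s t : d < s -> cover_count d s t = 0.
Proof.
elim: d s t => [|d IH] [|s] [|t] //= ds; rewrite !IH //; lia.
Qed.

Lemma cover_count_lt_r d s t : d < t -> cover_count d s t = 0.
Proof.
elim: d s t => [|d IH] [|s] [|t] //= ds; rewrite !IH //; lia.
Qed.

Lemma cover_count_gt d s t : s + t < d -> cover_count d s t = 0.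
Proof.
elim: d s t => [|d IH] [|s] [|t] //= ds; rewrite !IH //; lia.
Qed.

(** In these parameters a elements lie in both subsets, b only in the second and
    e only in the first, and the recursion is the Pascal identity for
    multinomial coefficients. *)
Lemma cover_count_fact a b e :
  cover_count (a + b + e) (a + e) (a + b) * (a`! * b`! * e`!) = (a + b + e)`!.
Proof.
have [d E] : exists d, a + b + e = d by exists (a + b + e).
elim: d a b e E => [|d IH] a b e E.
  by have [-> -> ->] : [/\ a = 0, b = 0 & e = 0] by split; lia.
rewrite E factS -E !mulnDl E /= !mulnDl.
have -> : (if a + e is s'.+1 then cover_count d s' (a + b) else 0) *
    (a`! * b`! * e`!) = e * d`!.
  case: e E => [|e] E.
    by rewrite addn0; case: a E => // a E; rewrite cover_count_lt_r //; lia.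
  have {}E : a + b + e = d by lia.
  by rewrite addnS factS -[in RHS]E -IH // E; ring.
have -> : (if a + b is t'.+1 then cover_count d (a + e) t' else 0) *
    (a`! * b`! * e`!) = b * d`!.
  case: b E => [|b] E.
    by rewrite addn0; case: a E => // a E; rewrite cover_count_lt_l //; lia.
  have {}E : a + b + e = d by lia.
  by rewrite addnS factS -[in RHS]E -IH // E; ring.
suff -> : (if a + e is s'.+1 then
             if a + b is t'.+1 then cover_count d s' t' else 0 else 0) *
    (a`! * b`! * e`!) = a * d`! by ring.
case: a E => [|a] E.
  rewrite !add0n; case: e E => // e E; case: b E => // b E.
  by rewrite cover_count_gt //; lia.
have {}E : a + b + e = d by lia.
by rewrite !addSn factS -[in RHS]E -IH // E; ring.
Qed.

Lemma cover_countE d s t : maxn s t <= d < (s + t).+1 ->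
  cover_count d s t = d`! %/ ((s + t - d)`! * (d - s)`! * (d - t)`!).
Proof.
rewrite geq_max => /andP[/andP[sd td] dst].
have := cover_count_fact (s + t - d) (d - s) (d - t).
have -> : s + t - d + (d - s) + (d - t) = d by lia.
have -> : s + t - d + (d - t) = s by lia.
have -> : s + t - d + (d - s) = t by lia.
by move=> <-; rewrite mulnK // !muln_gt0 !fact_gt0.
Qed.

End Multinomial.

Section Defect.
Variables (R : comPzRingType) (c : R).
Implicit Type a : nat -> R.

(** The coefficient of X^s Y^t in (X + Y + c X Y)^d. For d > s + t, where the
    truncated exponent of c is meaningless, the count vanishes. *)
Definition weight d s t : R := (cover_count d s t)%:R * c ^+ (s + t - d).

(** The failure of the product formula for a; in terms of the series F with
    coefficients a, the coefficient of X^s Y^t in F(X) F(Y) - F(X + Y + c X Y). *)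
Definition defect a s t : R :=
  a s * a t - \sum_(d < (s + t).+1) weight d s t * a d.

Lemma weightS d s t : weight d.+1 s t =
  (if s is s'.+1 then weight d s' t else 0) +
  (if t is t'.+1 then weight d s t' else 0) +
  c * (if s is s'.+1 then if t is t'.+1 then weight d s' t' else 0 else 0).
Proof.
rewrite /weight /= !natrD !mulrDl; congr (_ + _ + _).
- by case: s => [|s]; rewrite ?mul0r // addSn subSS.
- by case: t => [|t]; rewrite ?mul0r // addnS subSS.
case: s => [|s]; first by rewrite mul0r mulr0.
case: t => [|t]; first by rewrite mul0r mulr0.
have [dst|dst] := leqP d (s + t).
  rewrite mulrCA -exprS; congr (_ * c ^+ _); lia.
by rewrite cover_count_gt // !mul0r mulr0.
Qed.

Lemma weight_sum a s t N : (s + t < N)%N ->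
  \sum_(d < (s + t).+1) weight d s t * a d = \sum_(d < N) weight d s t * a d.
Proof.
move=> stN; rewrite (big_ord_widen N (fun d => weight d s t * a d)) //.
rewrite [RHS](bigID (fun d : 'I_N => (d < (s + t).+1)%N)) /=.
rewrite [X in _ = _ + X]big1 ?addr0 //.
by move=> d; rewrite -leqNgt => std; rewrite /weight cover_count_gt // !mul0r.
Qed.

(** Multiplication by 1 + y t. *)
Definition mulshift (y : R) a : nat -> R :=
  fun d => if d is d'.+1 then a d'.+1 + y * a d' else a 0%N.

(** For G = (1 + y t) F the defect series gets multiplied by
    (1 + y X) (1 + y Y) = 1 + y (X + Y + c X Y). *)
Lemma defect_mulshift y a s t : y * y = c * y ->
  defect (mulshift y a) s t = defect a s t + y * (
    (if s is s'.+1 then defect a s' t else 0) +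
    (if t is t'.+1 then defect a s t' else 0) +
    c * (if s is s'.+1 then if t is t'.+1 then defect a s' t' else 0 else 0)).
Proof.
move=> yy; rewrite /defect.
have -> : \sum_(d < (s + t).+1) weight d s t * mulshift y a d =
   \sum_(d < (s + t).+1) weight d s t * a d +
   y * \sum_(d < s + t) weight d.+1 s t * a d.
  rewrite !big_ord_recl /= -addrA; congr (_ + _).
  rewrite big_distrr -big_split /=; apply: eq_bigr => d _.
  by rewrite /bump /= add1n; ring.
have -> : \sum_(d < s + t) weight d.+1 s t * a d =
   (if s is s'.+1 then \sum_(d < (s' + t).+1) weight d s' t * a d else 0) +
   (if t is t'.+1 then \sum_(d < (s + t').+1) weight d s t' * a d else 0) +
   c * (if s is s'.+1 then if t is t'.+1 then
     \sum_(d < (s' + t').+1) weight d s' t' * a d else 0 else 0).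
  under eq_bigr => d _ do rewrite weightS !mulrDl.
  rewrite !big_split /=; congr (_ + _ + _).
  - case: s => [|s]; first by rewrite big1 // => d _; rewrite mul0r.
    by rewrite addSn.
  - case: t => [|t]; first by rewrite big1 // => d _; rewrite mul0r.
    by rewrite addnS.
  under eq_bigr => d _ do rewrite -mulrA.
  rewrite -big_distrr /=; congr (_ * _).
  case: s => [|s]; first by rewrite big1 // => d _; rewrite mul0r.
  case: t => [|t]; first by rewrite big1 // => d _; rewrite mul0r.
  by rewrite (@weight_sum a s t (s.+1 + t.+1)) //; lia.
case: s => [|s]; case: t => [|t] /=; try by ring.
have -> : (a s.+1 + y * a s) * (a t.+1 + y * a t) = a s.+1 * a t.+1 +
   y * (a s * a t.+1 + a s.+1 * a t) + y * y * (a s * a t) by ring.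
by rewrite yy; ring.
Qed.

(** In the direction from right to left this is division by 1 + y t, by induction
    on s + t. It allows to remove a Pfister element without computing the
    inverse series. *)
Lemma defect0_mulshift y a : y * y = c * y ->
  (forall s t, defect a s t = 0) <-> (forall s t, defect (mulshift y a) s t = 0).
Proof.
move=> yy; split=> H s t.
  by rewrite defect_mulshift //; case: s => [|s]; case: t => [|t]; rewrite ?H; ring.
have [N] : exists N, (s + t < N)%N by exists (s + t).+1.
elim: N s t => // N IH s t stN.
have := H s t; rewrite defect_mulshift //.
have -> : (if s is s'.+1 then defect a s' t else 0) = 0.
  by case: s stN => // s stN; apply: IH; lia.
have -> : (if t is t'.+1 then defect a s t' else 0) = 0.
  by case: t stN => // t stN; apply: IH; lia.
have -> : (if s is s'.+1 then if t is t'.+1 then defect a s' t' else 0 else 0) = 0.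
  by case: s stN => // s; case: t => // t stN; apply: IH; lia.
by rewrite mulr0 !addr0 mulr0 addr0.
Qed.

Lemma defect_one s t : defect (fun d => (d == 0%N)%:R) s t = 0.
Proof.
rewrite /defect big_ord_recl /= big1 => [|d _]; last by rewrite mulr0.
rewrite addr0 mulr1 -natrM mulnb /weight /= subn0.
by case: s => [|s]; case: t => [|t]; rewrite /= ?mul0r ?expr0 ?mulr1 subrr.
Qed.

End Defect.

(** * Powers of the fundamental ideal and Pfister elements *)

Section Span.
Variable K : fieldType.
Hypothesis two_neq0 : (2%:R : K) != 0.
Implicit Types (a b : Kstar K) (x y : GW K) (p q : isoclass K).

(** The additive group generated by the n-fold Pfister elements, presented so that
    inductions add or remove one Pfister element at a time. *)
Inductive pf_span n : GW K -> Prop :=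
| pf_span0 : pf_span n 0
| pf_spanD x phi : pf_span n x -> Pf n phi -> pf_span n (x + phi)
| pf_spanB x phi : pf_span n x -> Pf n phi -> pf_span n (x - phi).

Lemma pf_span_Pf n phi : Pf n phi -> pf_span n phi.
Proof. by move=> Pphi; rewrite -[phi]add0r; apply: pf_spanD => //; apply: pf_span0. Qed.

Lemma pf_span_add n x y : pf_span n x -> pf_span n y -> pf_span n (x + y).
Proof.
move=> Sx; elim=> [|z phi _ IH Pphi|z phi _ IH Pphi]; rewrite ?addr0 ?addrA //.
  exact: pf_spanD.
exact: pf_spanB.
Qed.

Lemma pf_span_opp n x : pf_span n x -> pf_span n (- x).
Proof.
elim=> [|z phi _ IH Pphi|z phi _ IH Pphi]; rewrite ?oppr0 ?opprB ?opprD ?opprK.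
- exact: pf_span0.
- exact: pf_spanB.
by rewrite addrC; apply: pf_spanD.
Qed.

Lemma pf_span_sub n x y : pf_span n x -> pf_span n y -> pf_span n (x - y).
Proof. by move=> Sx Sy; apply: pf_span_add => //; apply: pf_span_opp. Qed.

Lemma pf_span_sum n m (F : 'I_m -> GW K) :
  (forall i, pf_span n (F i)) -> pf_span n (\sum_i F i).
Proof.
move=> SF; apply: (big_ind (pf_span n)) => //; first exact: pf_span0.
by move=> x y; apply: pf_span_add.
Qed.

Lemma PfM n m (phi psi : GW K) : Pf n phi -> Pf m psi -> Pf (n + m) (phi * psi).
Proof.
move=> [a ->] [b ->]; exists [tuple of a ++ b].
by rewrite !pfister_seqE /pfister_seq big_cat.
Qed.

Lemma pf_span_PfM n m (phi x : GW K) : Pf n phi -> pf_span m x -> pf_span (n + m) (phi * x).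
Proof.
move=> Pphi; elim=> [|z psi _ IH Ppsi|z psi _ IH Ppsi].
- by rewrite mulr0; apply: pf_span0.
- by rewrite mulrDr; apply: pf_spanD => //; apply: PfM.
by rewrite mulrBr; apply: pf_spanB => //; apply: PfM.
Qed.

Lemma pf_span_mul n m x y : pf_span n x -> pf_span m y -> pf_span (n + m) (x * y).
Proof.
move=> Sx Sy; elim: Sx => [|z phi _ IH Pphi|z phi _ IH Pphi].
- by rewrite mul0r; apply: pf_span0.
- by rewrite mulrDl; apply: pf_span_add => //; apply: pf_span_PfM.
by rewrite mulrBl; apply: pf_span_sub => //; apply: pf_span_PfM.
Qed.

(** Here n.+1 matters: the relation <a><<b>> = <<ab>> - <<a>> uses up one slot of
    the symbol. *)
Lemma pf_span_diag n a x : pf_span n.+1 x -> pf_span n.+1 (diag_class a * x).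
Proof.
have gen phi : Pf n.+1 phi -> pf_span n.+1 (diag_class a * phi).
  case=> c ->; rewrite pfister_seqE; case/tupleP: c => b c.
  rewrite /pfister_seq big_cons mulrA.
  have -> : diag_class a * pfister1 b = pfister1 (Kmul a b) - pfister1 a.
    by rewrite /pfister1 -diag_classM diag_class1; ring.
  rewrite mulrBl; apply: pf_span_sub; apply: pf_span_Pf.
    by exists [tuple of Kmul a b :: c]; rewrite pfister_seqE /pfister_seq big_cons.
  by exists [tuple of a :: c]; rewrite pfister_seqE /pfister_seq big_cons.
elim=> [|z phi _ IH Pphi|z phi _ IH Pphi].
- by rewrite mulr0; apply: pf_span0.
- by rewrite mulrDr; apply: pf_span_add => //; apply: gen.
by rewrite mulrBr; apply: pf_span_sub => //; apply: gen.
Qed.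

Lemma pf_span_scale n c x : pf_span n.+1 x -> pf_span n.+1 (c * x).
Proof.
move=> Sx; have gen p : pf_span n.+1 (ginj p * x).
  elim/(iso_ind two_neq0): p => [|a p IH]; first by rewrite ginj0 mul0r; apply: pf_span0.
  by rewrite ginjD mulrDl; apply: pf_span_add => //; apply: pf_span_diag.
by have [p [q ->]] := GW_sub c; rewrite mulrBl; apply: pf_span_sub.
Qed.

(** A difference of two diagonal forms with as many entries on both sides is a
    difference of sums of the 1 - <a_i>. *)
Lemma Ihat_span x : Ihat x -> pf_span 1 x.
Proof.
have gen p : pf_span 1 ((iso_dim p)%:R - ginj p).
  elim/(iso_ind two_neq0): p => [|a p IH].
    by rewrite iso_dimE ginj0 subr0; apply: pf_span0.
  rewrite iso_dimD iso_dimE ginjD.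
  have -> : (1 + iso_dim p)%:R - (ginj (cls (diag1 a)) + ginj p) =
    ((iso_dim p)%:R - ginj p) + pfister1 a :> GW K.
    by rewrite natrD /pfister1 diag_class1 /diag_class; ring.
  by apply: pf_spanD => //; exists [tuple a]; rewrite pfister_seqE /pfister_seq big_seq1.
rewrite /Ihat -[x]gcls_repr vdimE => /eqP; rewrite subr_eq0 eqz_nat => /eqP E.
rewrite gcls_sub; set p := (repr x).1 in E *; set q := (repr x).2 in E *.
have -> : ginj p - ginj q = ((iso_dim q)%:R - ginj q) - ((iso_dim p)%:R - ginj p).
  by rewrite E; ring.
by apply: pf_span_sub; apply: gen.
Qed.

Lemma Ihat_pow_span n x : (0 < n)%N -> Ihat_pow n x -> pf_span n x.
Proof.
case: n => // n _ [m [c [y [Iy ->]]]]; apply: pf_span_sum => i; apply: pf_span_scale.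
have {}Iy j := Ihat_span (Iy i j).
elim: {m c i} n.+1 {y}(y i) Iy => [|l IH] z Sz.
  rewrite big_ord0; apply: pf_span_Pf; exists [tuple].
  by rewrite pfister_seqE /pfister_seq big_nil.
by rewrite big_ord_recl; apply: (@pf_span_mul 1) => //; apply: IH.
Qed.

Lemma Ihat_pfister1 a : Ihat (pfister1 a).
Proof.
rewrite /Ihat /pfister1 /diag_class.
have := gcls_sub (cls (diag1 (Kone K)), cls (diag1 a)) => /= <-.
by rewrite vdimE /= !iso_dimE /= subrr.
Qed.

Lemma span_Ihat_pow n x : pf_span n x -> Ihat_pow n x.
Proof.
have step z phi (e : GW K) : Ihat_pow n z -> Pf n phi -> Ihat_pow n (z + e * phi).
  move=> [m [c [y [Iy ->]]]] [a ->].
  exists m.+1, (fun i => if unlift ord0 i is Some j then c j else e),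
    (fun i j => if unlift ord0 i is Some l then y l j else pfister1 (tnth a j)).
  split=> [i j|]; first by case: unliftP => [l _|_]; [apply: Iy | apply: Ihat_pfister1].
  rewrite big_ord_recl unlift_none addrC; congr (_ + _).
  by apply: eq_bigr => i _; rewrite liftK.
elim=> [|z phi _ IH Pphi|z phi _ IH Pphi].
- exists 0%N, (fun _ => 0), (fun _ _ => 0); rewrite big_ord0; split=> // i.
  by case: i.
- by rewrite -[phi]mul1r; apply: step.
by rewrite -[phi]mul1r -mulNr; apply: step.
Qed.

(** For the removal of a Pfister element, [pi_opD_pfister] determines pi_op at
    z - phi from its value at z and from its own lower degrees. *)
Lemma pi_op_span n d x : (0 < n)%N -> pf_span n x -> pf_span (n * d) (pi_op n d x).
Proof.
move=> n_gt0 Sx; have one : pf_span (n * 0) (1 : GW K).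
  rewrite muln0; apply: pf_span_Pf; exists [tuple].
  by rewrite pfister_seqE /pfister_seq big_nil.
elim: Sx d => [|z phi _ IH Pphi|z phi _ IH Pphi] [|d]; rewrite ?pi_op_deg0 //.
- by rewrite pi_op_zero //; apply: pf_span0.
- rewrite pi_opD_pfister //; apply: pf_span_add => //.
  by rewrite mulnS; apply: pf_span_PfM.
elim: d => [|d IHd].
  have := pi_opD_pfister two_neq0 0 (z - phi) n_gt0 Pphi; rewrite subrK => E.
  have -> : pi_op n 1 (z - phi) = pi_op n 1 z - phi * pi_op n 0 (z - phi).
    by rewrite E addrK.
  by apply: pf_span_sub => //; rewrite mulnS; apply: pf_span_PfM; rewrite ?pi_op_deg0.
have := pi_opD_pfister two_neq0 d.+1 (z - phi) n_gt0 Pphi; rewrite subrK => E.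
have -> : pi_op n d.+2 (z - phi) = pi_op n d.+2 z - phi * pi_op n d.+1 (z - phi).
  by rewrite E addrK.
by apply: pf_span_sub => //; rewrite [(n * d.+2)%N]mulnS; apply: pf_span_PfM.
Qed.

End Span.

(** * The invariants f_n^d *)

Section Invariants.
Variables (k : fieldType) (A : filt_functor k) (f : pfister_family A) (K : fext k).
Hypothesis two_neq0 : (2%:R : K) != 0.
Implicit Types (x : GW K).
Let c := pf_m1 f K.

Lemma pf_f0 n : (0 < n)%N -> pf_f f n (0 : GW K) = 0.
Proof.
move=> n_gt0; have S0 : Ihat_pow n (0 : GW K) by apply/span_Ihat_pow/pf_span0.
by have := pf_f_add f n_gt0 S0 S0; rewrite addr0 -[LHS]addr0 => /addrI.
Qed.

Lemma pf_f_sub n (x y : GW K) : (0 < n)%N -> pf_span n x -> pf_span n y ->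
  pf_f f n (x - y) = pf_f f n x - pf_f f n y.
Proof.
move=> n_gt0 Sx Sy; have Sxy := pf_span_sub Sx Sy.
have := pf_f_add f n_gt0 (span_Ihat_pow Sxy) (span_Ihat_pow Sy).
by rewrite subrK => ->; rewrite addrK.
Qed.

Lemma symbE n (a : n.-tuple (Kstar K)) :
  symb (pf_f f) a = \prod_(b <- a) pf_f f 1 (pfister1 b).
Proof. by rewrite /symb big_tuple. Qed.

Lemma pf_f_PfM n m (phi psi : GW K) : (0 < n)%N -> (0 < m)%N -> Pf n phi -> Pf m psi ->
  pf_f f (n + m) (phi * psi) = pf_f f n phi * pf_f f m psi :> A K.
Proof.
move=> n0 m0 [a ->] [b ->].
have -> : pfister a * pfister b = pfister [tuple of a ++ b].
  by rewrite !pfister_seqE /pfister_seq big_cat.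
by rewrite !pf_f_pfister ?addn_gt0 ?n0 // !symbE big_cat.
Qed.

(** Both sides are additive in x, so it is enough to concatenate symbols. *)
Lemma pf_f_mul n m (phi x : GW K) : (0 < n)%N -> (0 < m)%N -> Pf n phi -> pf_span m x ->
  pf_f f (n + m) (phi * x) = pf_f f n phi * pf_f f m x :> A K.
Proof.
move=> n0 m0 Pphi; have nm0 : (0 < n + m)%N by rewrite addn_gt0 n0.
elim=> [|z psi Sz IH Ppsi|z psi Sz IH Ppsi].
- by rewrite mulr0 !pf_f0 // mulr0.
- have [Ipz Ipp] := (pf_span_PfM Pphi Sz, pf_span_PfM Pphi (pf_span_Pf Ppsi)).
  rewrite mulrDr (pf_f_add f nm0 (span_Ihat_pow Ipz) (span_Ihat_pow Ipp)).
  rewrite (pf_f_add f m0 (span_Ihat_pow Sz) (span_Ihat_pow (pf_span_Pf Ppsi))).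
  by rewrite IH pf_f_PfM // mulrDr.
have Sp := pf_span_Pf Ppsi.
by rewrite mulrBr !pf_f_sub //; try exact: pf_span_PfM; rewrite IH pf_f_PfM // mulrBr.
Qed.

Lemma symb1_sq b : pf_f f 1 (pfister1 b) * pf_f f 1 (pfister1 b) =
  c * pf_f f 1 (pfister1 b) :> A K.
Proof.
have /(pf_inj f) : pfister [tuple b; b] = pfister [tuple b; Kopp1 K].
  by rewrite !pfister_seqE /pfister_seq !big_cons big_nil !mulr1 pfister1_sq.
by rewrite !symbE !big_cons big_nil !mulr1 => ->; rewrite mulrC.
Qed.

Lemma pf_f_sq n (phi : GW K) : (0 < n)%N -> Pf n phi ->
  pf_f f n phi * pf_f f n phi = c ^+ n * pf_f f n phi :> A K.
Proof.
move=> n_gt0 [a ->]; rewrite pf_f_pfister // symbE -[in c ^+ n](size_tuple a).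
elim: {n n_gt0 a}(tval a) => [|b s IH]; first by rewrite big_nil.
by rewrite big_cons mulrACA IH symb1_sq /= exprS; ring.
Qed.

Lemma pf_div_add_pfister n (x phi : GW K) : (0 < n)%N -> pf_span n x -> Pf n phi ->
  (fun d => pf_div f n d (x + phi)) =
  mulshift (pf_f f n phi) (fun d => pf_div f n d x) :> (nat -> A K).
Proof.
move=> n_gt0 Sx Pphi; apply/funext => -[|d] //=.
rewrite pi_opD_pfister // pf_f_add ?muln_gt0 ?n_gt0 //; last first.
- by rewrite mulnS; apply/span_Ihat_pow/pf_span_PfM => //; apply: pi_op_span.
- exact/span_Ihat_pow/pi_op_span.
congr (_ + _); case: d => [|d]; first by rewrite pi_op_deg0 // muln1 !mulr1.
rewrite mulnS pf_f_mul ?muln_gt0 ?n_gt0 //; exact: pi_op_span.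
Qed.

Lemma defect_pf_div n x s t : (0 < n)%N -> pf_span n x ->
  defect (c ^+ n) (fun d => pf_div f n d x) s t = 0.
Proof.
move=> n_gt0 Sx; elim: Sx s t => [|z phi Sz IH Pphi|z phi Sz IH Pphi] s t.
- have -> : (fun d => pf_div f n d (0 : GW K)) = (fun d => (d == 0%N)%:R) :> (nat -> A K).
    apply/funext => -[|d] //=; rewrite pi_op_zero // pf_f0 // muln_gt0 n_gt0 //.
  exact: defect_one.
- rewrite pf_div_add_pfister //.
  by have [+ _] := defect0_mulshift (fun d => pf_div f n d z) (pf_f_sq n_gt0 Pphi); apply.
have Szphi : pf_span n (z - phi) by apply: pf_spanB.
have [_] := defect0_mulshift (fun d => pf_div f n d (z - phi)) (pf_f_sq n_gt0 Pphi).
by rewrite -pf_div_add_pfister // subrK; apply.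
Qed.

End Invariants.

Theorem proposition1p2p46 (k : fieldType) (char_k : 2%N \notin [pchar k])
    (A : filt_functor k) (f : pfister_family A) (n s t : nat) (n_gt0 : (0 < n)%N) :
  forall (K : fext k) (x : GW K), Ihat_pow n x ->
    pf_div f n s x * pf_div f n t x =
    \sum_(maxn s t <= d < (s + t).+1)
      (d`! %/ ((s + t - d)`! * (d - s)`! * (d - t)`!))%N%:R *
      pf_m1 f K ^+ (n * (s + t - d)) * pf_div f n d x.
Proof.
move=> K x Ix; have two_neq0 : (2%:R : K) != 0.
  rewrite -(rmorph_nat (fext_emb K)) fmorph_eq0.
  by apply: contra char_k => k2; rewrite inE k2.
have /eqP := defect_pf_div f two_neq0 s t n_gt0 (Ihat_pow_span two_neq0 n_gt0 Ix).
rewrite subr_eq0 => /eqP ->.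
rewrite -(big_mkord xpredT (fun d => weight (pf_m1 f K ^+ n) d s t * pf_div f n d x)).
rewrite (@big_cat_nat _ _ _ (maxn s t)) //=; last by rewrite geq_max; lia.
rewrite big_nat big1 ?add0r => [|d /andP[_]].
  by rewrite !big_nat; apply: eq_bigr => d dst; rewrite /weight cover_countE // exprM.
rewrite leq_max /weight => /orP[ds|dt].
  by rewrite cover_count_lt_l // !mul0r.
by rewrite cover_count_lt_r // !mul0r.
Qed.
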